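(* Let $\mathfrak{q}$ be a maximal parabolic subalgebra of quasi-Heisenberg type of a complex simple Lie algebra $\mathfrak{g}$, and let $V^*$ be an irreducible $L$-constituent of $\mathfrak{g}(1)\otimes\mathfrak{z}(\bar{\mathfrak{n}})$. Then $\tilde\tau_1|_{V^*}$ is not identically zero if and only if $V^*\cong\mathfrak{g}(-1)$ as an $L$-module.
   Context: $\mathfrak{g}$ is a complex simple Lie algebra with Borel subalgebra $\mathfrak{b}\supset\mathfrak{h}$ (Cartan), roots $\Delta$, simple roots $\Pi$, Killing form $\kappa$. For $\alpha_\mathfrak{q}\in\Pi$, $\mathfrak{q}=\mathfrak{l}\oplus\mathfrak{n}$ is the standard maximal parabolic: $\mathfrak{l}=\mathfrak{h}$ plus root spaces for roots in $\mathrm{span}(\Pi\setminus\{\alpha_\mathfrak{q}\})$, $\mathfrak{n}$ the remaining positive root spaces. It is of quasi-Heisenberg type if $[\mathfrak{n},[\mathfrak{n},\mathfrak{n}]]=0$ and $\dim[\mathfrak{n},\mathfrak{n}]>1$. Grading by the coefficient of $\alpha_\mathfrak{q}$ gives $\mathfrak{g}=\bigoplus_{j=-2}^2\mathfrak{g}(j)$ with $\mathfrak{l}=\mathfrak{g}(0)$, $\mathfrak{z}(\mathfrak{n})=\mathfrak{g}(2)$ and $\mathfrak{z}(\bar{\mathfrak{n}})=\mathfrak{g}(-2)$. $L$ is the Levi subgroup with Lie algebra $\mathfrak{l}$ of $Q=N_G(\mathfrak{q})$, $G$ the connected simply connected complex group of $\mathfrak{g}$, acting by $\mathrm{Ad}$.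 Let $\omega=\sum_jX_j^*\otimes X_j\in\mathfrak{g}(-2)\otimes\mathfrak{g}(2)$, with $\{X_j\}$ a basis of $\mathfrak{g}(2)$ and $\{X_j^*\}$ its $\kappa$-dual basis of $\mathfrak{g}(-2)$; $\tau_1:\mathfrak{g}(1)\to\mathfrak{g}(-1)\otimes\mathfrak{z}(\mathfrak{n})$, $\tau_1(X)=(\mathrm{ad}(X)\otimes\mathrm{Id})\omega$. Identify $(\mathfrak{g}(-1)\otimes\mathfrak{z}(\mathfrak{n}))^*\cong\mathfrak{g}(1)\otimes\mathfrak{z}(\bar{\mathfrak{n}})$ via $\kappa$ (so $A\otimes B$ acts as $\kappa(A,\cdot)\kappa(B,\cdot)$). For $Y^*\in\mathfrak{g}(1)\otimes\mathfrak{z}(\bar{\mathfrak{n}})$, $\tilde\tau_1(Y^* )$ is the linear polynomial $X\mapsto Y^*(\tau_1(X))$ on $\mathfrak{g}(1)$, and $\tilde\tau_1|_{V^*}$ is the restriction of $Y^*\mapsto\tilde\tau_1(Y^* )$ to $V^*$. *)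

(* Defs.v *)
From mathcomp Require Import all_boot all_order all_algebra complex.
From mathcomp Require Import classical_sets reals topology normedtype sequences.

Set Implicit Arguments.
Unset Strict Implicit.
Unset Printing Implicit Defensive.

Import Order.TTheory GRing.Theory Num.Theory.
Import numFieldNormedType.Exports.

Local Open Scope classical_set_scope.
Local Open Scope ring_scope.

Section LinearAlgebra.
Context {K : numFieldType}.
Implicit Types U V W : vectType K.

Definition lf_trace V (f : 'End(V)) : K :=
  \sum_i coord (vbasis {:V}) i (f (vbasis {:V})`_i).

Definition lf_diagonalizable V (f : 'End(V)) : Prop :=
  exists2 b : seq V, basis_of {:V} b &
    forall v, v \in b -> exists c : K, f v = c *: v.

(* [e] is the sum of the exponential series of [f]; convergence in the finite
   dimensional space [V] is convergence of coordinates. *)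
Definition is_exp V (f e : 'End(V)) : Prop :=
  forall (v : V) (i : 'I_(\dim {:V})),
    (fun n : nat => coord (vbasis {:V}) i
        (\sum_(k < n) (k`!%:R)^-1 *: iter k f v)) @ \oo
      --> coord (vbasis {:V}) i (e v).

Definition is_subgroup V (H : set 'End(V)) : Prop :=
  [/\ H \1%VF,
      forall f g, H f -> H g -> H (f \o g)%VF
    & forall f, H f -> exists2 g, H g & (f \o g = \1)%VF /\ (g \o f = \1)%VF].

Definition gen_subgroup V (A : set 'End(V)) : set 'End(V) :=
  [set f | forall H : set 'End(V), is_subgroup H -> A `<=` H -> H f].

(* Elements of U ⊗ V are represented by their coordinate matrices in the
   basis (u_i ⊗ v_j) attached to the bases [vbasis {:U}] and [vbasis {:V}]. *)
Definition tensor U V : vectType K := 'M[K]_(\dim {:U}, \dim {:V}).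

Definition tens U V (u : U) (v : V) : tensor U V :=
  \matrix_(i, j) (coord (vbasis {:U}) i u * coord (vbasis {:V}) j v).

Definition tens_space U V (A : {vspace U}) (B : {vspace V}) :
    {vspace tensor U V} :=
  <<[seq tens a b | a <- vbasis A, b <- vbasis B]>>%VS.

(* The linear map f ⊗ g. *)
Definition tens_map U V (f : 'End(U)) (g : 'End(V)) (t : tensor U V) :
    tensor U V :=
  \sum_i \sum_j t i j *: tens (f (vbasis {:U})`_i) (g (vbasis {:V})`_j).

(* The bilinear pairing with (a ⊗ b, c ⊗ d) |-> kU(a, c) kV(b, d). *)
Definition tens_pair U V (kU : U -> U -> K) (kV : V -> V -> K)
    (s t : tensor U V) : K :=
  \sum_i \sum_j \sum_k \sum_l s i j * t k l *
    (kU (vbasis {:U})`_i (vbasis {:U})`_k *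
     kV (vbasis {:V})`_j (vbasis {:V})`_l).

End LinearAlgebra.

(* Modules over a group [L] of automorphisms of [V]: an ambient space [W] on
   which f \in L acts by [rho f], and subspaces of [W]. *)
Section Modules.
Context {K : numFieldType} {V : vectType K} (L : set 'End(V)).

Definition is_submodule (W : vectType K) (rho : 'End(V) -> W -> W)
    (A : {vspace W}) : Prop :=
  forall f w, L f -> w \in A -> rho f w \in A.

Definition is_irreducible (W : vectType K) (rho : 'End(V) -> W -> W)
    (A : {vspace W}) : Prop :=
  [/\ A != 0%VS, is_submodule rho A
    & forall B : {vspace W}, (B <= A)%VS -> is_submodule rho B ->
        B = 0%VS \/ B = A].

Definition module_iso (W1 W2 : vectType K)
    (rho1 : 'End(V) -> W1 -> W1) (A1 : {vspace W1})
    (rho2 : 'End(V) -> W2 -> W2) (A2 : {vspace W2}) : Prop :=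
  exists F : 'Hom(W1, W2),
    [/\ (F @: A1)%VS = A2, (A1 :&: lker F)%VS = 0%VS
      & forall f w, L f -> w \in A1 -> F (rho1 f w) = rho2 f (F w)].

End Modules.

Record lieBracket (K : numFieldType) (g : vectType K) := LieBracket {
  bracket :> g -> g -> g;
  bracket_linearl : forall y, linear (bracket^~ y);
  bracket_linearr : forall x, linear (bracket x);
  bracketxx : forall x, bracket x x = 0;
  bracket_jacobi : forall x y z,
    bracket x (bracket y z) + bracket y (bracket z x) +
    bracket z (bracket x y) = 0
}.

Section LieAlgebra.
Context {K : numFieldType} {g : vectType K} (br : lieBracket g).
Implicit Types (x y : g) (A B : {vspace g}).

Definition ad x : 'End(g) := linfun (br x).

Definition killing x y : K := lf_trace (ad x \o ad y)%VF.

Definition lie_prod A B : {vspace g} :=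
  <<[seq br a b | a <- vbasis A, b <- vbasis B]>>%VS.

Definition is_ideal A : Prop := forall x y, y \in A -> br x y \in A.

Definition is_abelian A : Prop :=
  forall x y, x \in A -> y \in A -> br x y = 0.

Definition is_simple : Prop :=
  ~ is_abelian fullv /\ (forall A, is_ideal A -> A = 0%VS \/ A = fullv).

(* Cartan subalgebras of a complex semisimple Lie algebra: the maximal abelian
   subalgebras consisting of ad-diagonalizable elements. *)
Definition is_cartan (h : {vspace g}) : Prop :=
  [/\ is_abelian h,
      forall A, is_abelian A -> (h <= A)%VS -> A = h
    & forall x, x \in h -> lf_diagonalizable (ad x)].

(* The image in GL(g) of a connected Lie group with Lie algebra [g]. *)
Definition Ad_group : set 'End(g) :=
  gen_subgroup [set e | exists x, is_exp (ad x) e].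

Definition Ad_normalizer A : set 'End(g) :=
  [set f | Ad_group f /\ (f @: A)%VS = A].

Definition lie_of_subgroup (L : set 'End(g)) : set g :=
  [set x | forall t : K, exists2 e, is_exp (ad (t *: x)) e & L e].

End LieAlgebra.

Definition dual (K : numFieldType) (g : vectType K) (h : {vspace g}) :
    vectType K :=
  'Hom(subvs_of h, K^o).

Section Roots.
Context {K : numFieldType} {g : vectType K} (br : lieBracket g).
Context {h : {vspace g}}.

Definition root_space (a : dual h) : {vspace g} :=
  (\bigcap_(H <- vbasis {:subvs_of h})
     lker (ad br (vsval H) - (a H : K) *: \1%VF)%R)%VS.

Definition is_root (a : dual h) : bool :=
  (a != 0) && (root_space a != 0%VS).

Definition lists_roots (Delta : seq (dual h)) : Prop :=
  forall a, (a \in Delta) = is_root a.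

Definition is_base (Delta : seq (dual h)) (r : nat) (Pi : r.-tuple (dual h)) :
    Prop :=
  [/\ basis_of fullv Pi, {subset Pi <= Delta}
    & forall b, b \in Delta -> exists c : 'I_r -> nat,
        b = \sum_i tnth Pi i *+ c i \/ b = - \sum_i tnth Pi i *+ c i].

(* From here on [Delta] lists the roots, [Pi] is a base of simple roots, and
   [q] is the index in [Pi] of the simple root alpha_q. *)
Context (Delta : seq (dual h)) (r : nat) (Pi : r.-tuple (dual h)) (q : 'I_r).

Definition is_positive (b : dual h) : bool := [forall i, 0 <= coord Pi i b].

Definition in_levi (b : dual h) : bool :=
  b \in <<[seq a <- Pi | a != tnth Pi q]>>%VS.

Definition levi : {vspace g} :=
  (h + \sum_(b <- Delta | in_levi b) root_space b)%VS.

Definition nilrad : {vspace g} :=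
  (\sum_(b <- Delta | is_positive b && ~~ in_levi b) root_space b)%VS.

Definition parabolic : {vspace g} := (levi + nilrad)%VS.

Definition grading (j : int) : {vspace g} :=
  ((if (j == 0)%R then h else 0) +
   \sum_(b <- Delta | (coord Pi q b == j%:~R)%R) root_space b)%VS.

Definition quasi_heisenberg : Prop :=
  lie_prod br nilrad (lie_prod br nilrad nilrad) = 0%VS /\
  (1 < \dim (lie_prod br nilrad nilrad))%N.

Definition unipotent_group : set 'End(g) :=
  gen_subgroup [set e | exists2 x, x \in nilrad & is_exp (ad br x) e].

(* [L] is (the image under Ad of) the Levi subgroup with Lie algebra [levi] of
   the normalizer Q of [parabolic]: Q is the semidirect product of [L] and of
   the unipotent radical N. *)
Definition is_levi_subgroup (L : set 'End(g)) : Prop :=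
  [/\ is_subgroup L,
      L `<=` Ad_normalizer br parabolic,
      forall f, Ad_normalizer br parabolic f ->
        exists a b, [/\ L a, unipotent_group b & f = (a \o b)%VF],
      forall f, L f -> unipotent_group f -> f = \1%VF
    & lie_of_subgroup br L = [set x | x \in levi]].

(* [X] is a basis of g(2) and [Xs] the dual basis of g(-2). *)
Definition dual_bases (m : nat) (X Xs : m.-tuple g) : Prop :=
  [/\ basis_of (grading 2) X, basis_of (grading (-2)) Xs
    & forall i j, killing br (tnth Xs i) (tnth X j) = (i == j)%:R].

End Roots.

Section Tau.
Context {K : numFieldType} {g : vectType K} (br : lieBracket g).

Definition tens_ad_action (f : 'End(g)) : tensor g g -> tensor g g :=
  tens_map f f.

Definition omega (m : nat) (X Xs : m.-tuple g) : tensor g g :=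
  \sum_j tens (tnth Xs j) (tnth X j).

Definition tau1 (m : nat) (X Xs : m.-tuple g) (x : g) : tensor g g :=
  tens_map (ad br x) \1%VF (omega X Xs).

Definition tau1_tilde (m : nat) (X Xs : m.-tuple g) (Y : tensor g g) (x : g) :
    K :=
  tens_pair (killing br) (killing br) Y (tau1 X Xs x).

End Tau.

(* Main.v *)
From HB Require Import structures.
Require Import Defs.
From mathcomp Require Import all_boot all_order all_algebra complex ring.
From mathcomp Require Import boolp classical_sets reals topology normedtype.
From mathcomp Require Import sequences exp.

Set Implicit Arguments.
Unset Strict Implicit.
Unset Printing Implicit Defensive.

Import Order.TTheory GRing.Theory Num.Theory.
Import numFieldNormedType.Exports.

Local Open Scope classical_set_scope.
Local Open Scope ring_scope.

(** Let phi : g(1) (x) g(-2) -> g(-1) be A (x) B |-> [B, A]. Invariance of the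
    Killing form kappa gives tau1~(Y)(X) = kappa(phi(Y), X), so tau1~ vanishes
    on V* exactly when phi does. As phi is L-equivariant and g(-1) is
    irreducible, a nonzero restriction of phi is an isomorphism onto g(-1).

    Conversely an isomorphism V* -> g(-1) turns into an l-equivariant bilinear
    map Psi on g(-1) with values in g(-2), by contracting the factor g(1). It is
    determined by its value at (highest vector, lowest vector), which lies in a
    root space, hence in a line; so Psi is a multiple c of the bracket. Then
    kappa(phi(Y), X) is c times kappa(y, [Z, X]) with Z = sum_k [X_k, X_k^*].
    This Z is central in l, so Z = c' E for the coweight E defining the grading,
    and c' kappa(E, E) = 2 dim g(2) is not 0. Hence phi = 0 on V* forces c = 0,
    that is Psi = 0, which is absurd.

    Irreducibility of g(-1), the vanishing of g(3) and g(2) = [g(1), g(1)] all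
    follow from the generation of the positive root spaces by the simple ones.
    A failure would produce a singular vector of negative weight; the submodule
    M that it generates would have trace 0 for rho (a combination of brackets
    of simple root vectors), though all weights of M are negative at rho. *)

(** * Linear algebra *)

(** The hypotheses speak of the group [L], the arguments on root vectors of its Lie algebra. For x
    in l, all [exp (t ad x)] lie in [L]; comparing first-order terms at t = 0 turns [L]-stable
    subspaces and [L]-equivariant maps into l-stable and l-equivariant ones. That phi commutes with
    [L] is a different matter: it holds because exponentials of derivations respect the bracket,
    which is a statement about Cauchy products of series.

    The obstacle in the converse is that an abstract isomorphism says nothing about how V* sits in
    the tensor product: a second copy of g(-1) could lie inside the kernel of phi. The uniqueness of
    Psi excludes it, since it says that Hom_l(g(-1), g(1) (x) g(-2)) is at most a line. The
    vanishing of g(3) enters when sum_k [[X, X_k^*], X_k] is rewritten as [Z, X].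

    Nondegeneracy of kappa also starts from kappa(E, E), which is a sum of squares of integers, not
    all 0. *)

Section Subspaces.
Context {K : fieldType} {V : vectType K}.
Implicit Types (A B M : {vspace V}) (P : V -> Prop).

(** A subspace of largest dimension among those contained in [P] is all of [P], since a missing
    vector could be adjoined. Inductions over elements thereby become inclusions of subspaces. *)
Lemma ex_vspace P :
  P 0 -> (forall a u v, P u -> P v -> P (a *: u + v)) ->
  exists A, forall v, v \in A <-> P v.
Proof.
move=> P0 PL.
pose Q n := `[< exists2 A, \dim A = n & forall v, v \in A -> P v >].
have exQ : exists n, Q n.
  exists 0%N; apply/asboolP; exists 0%VS; first exact: dimv0.
  by move=> v; rewrite memv0 => /eqP->.
have bQ n : Q n -> (n <= \dim {:V})%N.
  by move=> /asboolP[A <- _]; exact/dimvS/subvf.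
case: (ex_maxnP exQ bQ) => n /asboolP[A dA PA] maxn.
exists A => v; split=> [/PA //|Pv].
have : Q (\dim (A + <[v]>)).
  apply/asboolP; exists (A + <[v]>)%VS => // w /memv_addP[a aA [b /vlineP[k ->] ->]].
  by rewrite addrC; apply: PL => //; exact: PA.
move/maxn; rewrite -dA => le_d.
have /eqP -> : A == (A + <[v]>)%VS by rewrite eqEdim addvSl le_d.
by apply: (subvP (addvSr _ _)); exact: memv_line.
Qed.

(** Cyclic submodules are obtained as an intersection, not as words in [S] applied to [y]; the last
    clause is their induction principle. *)
Lemma ex_smallest_stable (S : (V -> V) -> Prop) (y : V) :
  exists M, [/\ y \in M, forall f v, S f -> v \in M -> f v \in M &
    forall B, y \in B -> (forall f v, S f -> v \in B -> f v \in B) ->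
      (M <= B)%VS].
Proof.
pose P v := forall B, y \in B -> (forall f v, S f -> v \in B -> f v \in B) -> v \in B.
have [||M MP] := @ex_vspace P.
- by move=> B _ _; rewrite mem0v.
- by move=> a u v Pu Pv B yB SB; rewrite memvD ?memvZ //; [apply: Pu | apply: Pv].
exists M; split.
- by apply/MP => B.
- by move=> f v Sf /MP Pv; apply/MP => B yB SB; apply: (SB) => //; exact: Pv.
- by move=> B yB SB; apply/subvP => v /MP; apply.
Qed.

Lemma span_extract_basis (s : seq V) :
  exists2 b : seq V, {subset b <= s} & free b /\ <<b>>%VS = <<s>>%VS.
Proof.
elim: s => [|x s [b sub [fb eb]]]; first by exists [::] => //; rewrite nil_free.
case: (boolP (x \in <<b>>%VS)) => xb.
  exists b; first by move=> z /sub zs; rewrite inE zs orbT.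
  split=> //; rewrite span_cons -eb; apply/esym/addv_idPr.
  by rewrite -memvE.
exists (x :: b).
  by move=> z; rewrite !inE => /orP[->//|/sub ->]; rewrite orbT.
by rewrite free_cons xb fb !span_cons eb.
Qed.

Lemma subv_sum_seqP (I : eqType) (s : seq I) (Q : pred I) (F : I -> {vspace V}) B :
  (forall i, i \in s -> Q i -> (F i <= B)%VS) ->
  (\sum_(i <- s | Q i) F i <= B)%VS.
Proof.
elim: s => [|i s IH] FB; first by rewrite big_nil sub0v.
have IH' : (\sum_(j <- s | Q j) F j <= B)%VS.
  by apply: IH => j js; apply: FB; rewrite inE js orbT.
rewrite big_cons; case: ifP => // Qi; rewrite subv_add IH' andbT.
by apply: FB; rewrite ?inE ?eqxx.
Qed.

Lemma memv_sum_seq (I : eqType) (s : seq I) (Q : pred I) (F : I -> {vspace V}) i v :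
  i \in s -> Q i -> v \in F i -> v \in (\sum_(j <- s | Q j) F j)%VS.
Proof.
move=> si Qi vF; rewrite (big_rem i) //= Qi.
by apply: (subvP (addvSl _ _)).
Qed.

End Subspaces.

Section Traces.
Context {K : fieldType} {V : vectType K}.

(** For a free [b] whose span is preserved by [f], this is the trace of the restriction of [f] to
    that span; [b] need not span [V]. *)
Definition trace_in n (b : n.-tuple V) (f : V -> V) : K :=
  \sum_i coord b i (f b`_i).

Lemma trace_inC n (b : n.-tuple V) (f g : 'End(V)) : free b ->
  (forall v, v \in <<b>>%VS -> f v \in <<b>>%VS) ->
  (forall v, v \in <<b>>%VS -> g v \in <<b>>%VS) ->
  trace_in b (f \o g) = trace_in b (g \o f).
Proof.
move=> fb fM gM.
have mb (i : 'I_n) : b`_i \in <<b>>%VS by apply: memv_span; rewrite mem_nth ?size_tuple.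
have E (u w : 'End(V)) : (forall v, v \in <<b>>%VS -> w v \in <<b>>%VS) ->
   trace_in b (u \o w) = \sum_(i < n) \sum_(j < n) coord b j (w b`_i) * coord b i (u b`_j).
  move=> wM; apply: eq_bigr => i _ /=.
  by rewrite {1}(coord_span (wM _ (mb i))) !linear_sum /=; apply: eq_bigr => j _; rewrite !linearZ.
rewrite !E // exchange_big /=; apply: eq_bigr => i _; apply: eq_bigr => j _.
by rewrite mulrC.
Qed.

Lemma trace_in_basis n m (b : n.-tuple V) (c : m.-tuple V) (f : 'End(V)) :
  basis_of fullv b -> basis_of fullv c -> trace_in b f = trace_in c f.
Proof.
move=> bb bc.
rewrite /trace_in.
transitivity (\sum_(i < n) \sum_(k < m) coord c k b`_i * coord b i (f c`_k)).
  apply: eq_bigr => i _.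
  rewrite {1}(coord_basis bc (memvf b`_i)) !linear_sum /=.
  by apply: eq_bigr => k _; rewrite !linearZ.
rewrite exchange_big /=; apply: eq_bigr => k _.
rewrite {2}(coord_basis bb (memvf (f c`_k))) linear_sum /=.
by apply: eq_bigr => i _; rewrite linearZ /= mulrC.
Qed.

End Traces.

Lemma ex_lfun (K : fieldType) (U W : vectType K) (f : U -> W) :
  linear f -> exists F : 'Hom(U, W), forall u, F u = f u.
Proof.
move=> f_lin; pose fM := GRing.isLinear.Build _ _ _ _ f f_lin.
pose fL : {linear U -> W} := HB.pack f fM.
by exists (linfun fL) => u; rewrite (lfunE fL).
Qed.

(** Sending [u] to the row of the values [B u e_i] is injective by nondegeneracy, hence onto by
    equality of dimensions. *)
Lemma ex_pairing_rep (K : fieldType) (U W : vectType K) (B : U -> W -> K) :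
  (forall u, scalar (B u)) -> (forall w, scalar (B^~ w)) ->
  \dim {:U} = \dim {:W} -> (forall u, (forall w, B u w = 0) -> u = 0) ->
  forall l : W -> K, scalar l -> exists u, forall w, B u w = l w.
Proof.
move=> Br Bl dUW nd l l_lin.
pose e := vbasis {:W}.
have scal (k : W -> K) : scalar k ->
    forall w, k w = \sum_i coord e i w * k e`_i.
  move=> k_lin w; have [F FE] := @ex_lfun K W K^o k k_lin.
  rewrite -FE {1}(coord_basis (vbasisP fullv) (memvf w)) linear_sum /=.
  apply: eq_bigr => i _; rewrite linearZ /= FE.
  by [].
have [|F FE] := @ex_lfun K U 'rV[K]_(\dim {:W}) (fun u => \row_i B u e`_i).
  by move=> a u v; apply/rowP => i; rewrite !mxE (Bl e`_i a u v).
have kF : lker F == 0%VS.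
  rewrite -subv0; apply/subvP => u; rewrite memv_ker FE => /eqP Fu0.
  rewrite memv0; apply/eqP/nd => w; rewrite (scal _ (Br u)) big1 // => i _.
  by have /rowP/(_ i) := Fu0; rewrite !mxE => ->; rewrite mulr0.
have FT : limg F = fullv.
  apply/eqP; rewrite eqEdim subvf /=.
  rewrite limg_dim_eq; last by rewrite (eqP kF) capv0.
  by rewrite dUW dimvf dim_matrix mul1r.
have /memv_imgP[u _ uE] : (\row_i l e`_i) \in limg F by rewrite FT memvf.
exists u => w; rewrite (scal _ (Br u)) (scal _ l_lin); apply: eq_bigr => i _.
by move: uE; rewrite FE => /rowP/(_ i); rewrite !mxE => ->.
Qed.

(** * Eigenvector decompositions inside a stable subspace *)

Section Diagonalizable.
Context {K : numFieldType} {V : vectType K} (f : 'End(V)).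

(** The product of the commuting operators [f - c] over the list; it kills [V] once the list
    contains all eigenvalues. *)
Let shifts (s : seq K) (v : V) : V := foldl (fun w c => f w - c *: w) v s.

Let shifts_linear s : linear (shifts s).
Proof.
elim: s => [//|c s IH] a u v /=; rewrite -IH; congr (shifts s _).
by rewrite linearP scalerDr opprD !scalerBr !scalerA (mulrC a) addrACA.
Qed.

Let shifts_eigen s c v :
  f v = c *: v -> shifts s v = (\prod_(d <- s) (c - d)) *: v.
Proof.
move=> fv; elim: s v fv => [|d s IH] v fv /=; first by rewrite big_nil scale1r.
rewrite IH; last by rewrite fv -scalerBl linearZ /= fv !scalerA mulrC.
by rewrite fv -scalerBl big_cons scalerA mulrC.
Qed.

(** Induction on a list of distinct eigenvalues whose product of shifts kills [v]: the vector
    [f v - c v] stays in [M] and is killed by a shorter product. *)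
Lemma diagonalizable_split (M : {vspace V}) : lf_diagonalizable f ->
  (forall v, v \in M -> f v \in M) -> forall v, v \in M ->
  exists (s : seq K) (w : K -> V),
    (forall c, c \in s -> w c \in M /\ f (w c) = c *: w c) /\
    v = \sum_(c <- s) w c.
Proof.
move=> [b bb eb] fM v vM.
have [s us sb] : exists2 s : seq K, uniq s &
    forall x, x \in b -> exists2 c, c \in s & f x = c *: x.
  elim: (b) eb => [_|x l IH el]; first by exists [::].
  have [|s us sl] := IH; first by move=> z zl; apply: el; rewrite inE zl orbT.
  have [c fx] := el x (mem_head _ _).
  exists (undup (c :: s)); first exact: undup_uniq.
  move=> z; rewrite inE => /orP[/eqP->|/sl[d ds fz]].
    by exists c => //; rewrite mem_undup mem_head.
  by exists d => //; rewrite mem_undup inE ds orbT.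
have {b bb eb sb} sv : shifts s v = 0.
  have [F FE] := ex_lfun (shifts_linear s).
  have : (fullv <= lker F)%VS.
    rewrite -(span_basis bb); apply/span_subvP => x /sb[c cs fx].
    rewrite memv_ker FE (shifts_eigen s fx) (big_rem c) //= subrr mul0r.
    by rewrite scale0r.
  by move/subvP/(_ v (memvf v)); rewrite memv_ker FE => /eqP.
exists s; elim: s us v vM sv => [_ v _ /= ->|c s IH /= /andP[cs us] v vM sv].
  by exists (fun=> 0); split=> //; rewrite big_nil.
have [|w [wP wE]] := IH us _ _ sv; first by rewrite memvB ?memvZ ?fM.
(* On the eigenvector [w d] the operator [f - c] is multiplication by [d - c]; so [v'] is a preimage
   of [f v - c v], and [v - v'] is an eigenvector for [c]. *)
pose v' := \sum_(d <- s) (d - c)^-1 *: w d.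
have v'M : v' \in M.
  by rewrite /v' big_seq rpred_sum // => d ds; rewrite memvZ //; case: (wP d ds).
have fv' : f v' - c *: v' = f v - c *: v.
  rewrite wE /v' linear_sum scaler_sumr -sumrB; rewrite big_seq [RHS]big_seq.
  apply: eq_bigr => d ds; have [_ fw] := wP d ds.
  rewrite linearZ /= fw !scalerA -scalerBl (mulrC c) -mulrBr mulVf ?scale1r //.
  by rewrite subr_eq0; apply: contraNneq cs => <-.
exists (fun d => if d == c then v - v' else (d - c)^-1 *: w d); split.
  move=> d; rewrite inE; case: eqP => [-> _|_ /= ds].
    split; first by rewrite memvB.
    rewrite linearB scalerBr /=.
    by rewrite -[f v](subrK (c *: v)) -fv' -!addrA addrC -!addrA addNr addr0 addrC.
  have [wM fw] := wP d ds.
  by rewrite memvZ // linearZ /= fw !scalerA mulrC.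
rewrite big_cons eqxx; apply/eqP; rewrite -subr_eq0 opprD addrA opprB addrCA subrr addr0.
rewrite subr_eq0; apply/eqP.
rewrite /v' big_seq [RHS]big_seq; apply: eq_bigr => d ds.
by case: eqP => // dc; rewrite -dc ds in cs.
Qed.

End Diagonalizable.

(** * Lie algebras and the Killing form *)

Section LieBasics.
Context {K : numFieldType} {g : vectType K} (br : lieBracket g).
Implicit Types (x y z : g) (M B : {vspace g}).

HB.instance Definition _ x :=
  GRing.isLinear.Build K g g *:%R (br x) (bracket_linearr br x).

Lemma brDl x y z : br (x + y) z = br x z + br y z.
Proof. by have := bracket_linearl br z 1 x y; rewrite !scale1r. Qed.

Lemma br0l z : br 0 z = 0.
Proof. by have := bracket_linearl br z (-1) 0 0; rewrite scaler0 addr0 scaleN1r addNr. Qed.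

Lemma brZl a x z : br (a *: x) z = a *: br x z.
Proof. by have := bracket_linearl br z a x 0; rewrite !addr0 br0l addr0. Qed.

Lemma brDr x y z : br x (y + z) = br x y + br x z. Proof. exact: linearD. Qed.
Lemma brZr a x y : br x (a *: y) = a *: br x y. Proof. exact: linearZ. Qed.
Lemma br0r x : br x 0 = 0. Proof. exact: linear0. Qed.

Lemma brC x y : br x y = - br y x.
Proof.
apply/eqP; rewrite -addr_eq0; apply/eqP.
have := bracketxx br (x + y).
by rewrite brDl !brDr !bracketxx add0r addr0.
Qed.

Lemma brNl x y : br (- x) y = - br x y.
Proof. by rewrite -scaleN1r brZl scaleN1r. Qed.

Lemma br_suml (I : Type) (s : seq I) (P : pred I) (F : I -> g) z :
  br (\sum_(i <- s | P i) F i) z = \sum_(i <- s | P i) br (F i) z.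
Proof.
apply: (big_morph (fun u => br u z)); [by move=> u v; exact: brDl | exact: br0l].
Qed.

Lemma br_br x y z : br x (br y z) = br (br x y) z + br y (br x z).
Proof.
have := bracket_jacobi br x y z.
rewrite [br z x]brC (brC z (br x y)) linearN /= => /eqP.
by rewrite subr_eq0 => /eqP <-; rewrite subrK.
Qed.

Lemma br_brl x y z : br (br x y) z = br x (br y z) - br y (br x z).
Proof. by rewrite (br_br x y z) addrK. Qed.

Lemma adE x y : ad br x y = br x y.
Proof. exact: lfunE. Qed.

Lemma killingE x y : killing br x y =
  trace_in (vbasis fullv) (fun z => br x (br y z)).
Proof. by apply: eq_bigr => i _; rewrite comp_lfunE !adE. Qed.

Lemma killing_linear x : scalar (killing br x).
Proof.
move=> a u v; rewrite !killingE [_ * _]mulr_sumr -big_split; apply: eq_bigr => i _ /=.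
by rewrite brDl brZl linearP linearP.
Qed.

HB.instance Definition _ x :=
  GRing.isLinear.Build K g K *%R (killing br x) (killing_linear x).

Lemma killingC x y : killing br x y = killing br y x.
Proof.
have bb := vbasisP {:g}.
have fb := basis_free bb.
have sb v : v \in <<vbasis {:g}>>%VS by rewrite (span_basis bb) memvf.
have := @trace_inC _ _ _ _ (ad br x) (ad br y) fb (fun v _ => sb _) (fun v _ => sb _).
have E u w : trace_in (vbasis {:g}) (ad br u \o ad br w) = killing br u w.
  by rewrite killingE; apply: eq_bigr => i _ /=; rewrite !adE.
by rewrite !E.
Qed.

Lemma killingDl x y z : killing br (x + y) z = killing br x z + killing br y z.
Proof. by rewrite !(killingC _ z) linearD. Qed.
Lemma killingZl a x z : killing br (a *: x) z = a * killing br x z.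
Proof. by rewrite !(killingC _ z) linearZ. Qed.
Lemma killingNl x z : killing br (- x) z = - killing br x z.
Proof. by rewrite !(killingC _ z) linearN. Qed.
Lemma killingBl x y z : killing br (x - y) z = killing br x z - killing br y z.
Proof. by rewrite killingDl killingNl. Qed.
Lemma killing0l z : killing br 0 z = 0.
Proof. by rewrite killingC linear0. Qed.
Lemma killingZr a x z : killing br x (a *: z) = a * killing br x z.
Proof. exact: linearZ. Qed.

Lemma killing_suml (I : Type) (s : seq I) (P : pred I) (F : I -> g) z :
  killing br (\sum_(i <- s | P i) F i) z = \sum_(i <- s | P i) killing br (F i) z.
Proof.
apply: (big_morph (fun u => killing br u z)); [by move=> u v; exact: killingDl | exact: killing0l].
Qed.

Lemma killing_br x y z : killing br (br x y) z = killing br x (br y z).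
Proof.
have tr_comp u v w : killing br (br u v) w =
    trace_in (vbasis {:g}) (fun t => br u (br v (br w t))) -
    trace_in (vbasis {:g}) (fun t => br v (br u (br w t))).
  by rewrite killingE /trace_in -sumrB; apply: eq_bigr => i _; rewrite br_brl linearB.
rewrite (killingC x) !tr_comp.
have bb := vbasisP {:g}.
have fb := basis_free bb.
have sb v : v \in <<vbasis {:g}>>%VS by rewrite (span_basis bb) memvf.
have C u v w : trace_in (vbasis {:g}) (fun t => br u (br v (br w t))) =
    trace_in (vbasis {:g}) (fun t => br v (br w (br u t))).
  have := @trace_inC _ _ _ _ (ad br u) (ad br v \o ad br w)%VF fb (fun v _ => sb _) (fun v _ => sb _).
  rewrite /trace_in => E.
  transitivity (\sum_i coord (vbasis fullv) i ((ad br u \o (ad br v \o ad br w)%VF) (vbasis fullv)`_i)).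
    by apply: eq_bigr => i _ /=; rewrite comp_lfunE !adE.
  by rewrite E; apply: eq_bigr => i _ /=; rewrite comp_lfunE !adE.
by rewrite (C x y z) (C y x z) (C x z y).
Qed.

Lemma killing_brN x y z : killing br (br x y) z = - killing br y (br x z).
Proof. by rewrite brC killingNl killing_br. Qed.

(** The radical of the form is an ideal, so one nonzero value is enough. It will be the value at the
    coweight [E q]. *)
Lemma simple_killing_nondegenerate x0 y0 : is_simple br ->
  killing br x0 y0 != 0 -> forall x, (forall y, killing br x y = 0) -> x = 0.
Proof.
move=> [_ ideal_g] k0.
have [||A AP] := @ex_vspace K g (fun x => forall y, killing br x y = 0).
- by move=> y; rewrite killing0l.
- by move=> a u v u0 v0 y; rewrite killingDl killingZl u0 v0 mulr0 addr0.
have [| A0|AT] := ideal_g A.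
- by move=> x y /AP y0'; apply/AP => z; rewrite killing_brN y0' oppr0.
- by move=> x /AP; rewrite A0 memv0 => /eqP.
- have /AP/(_ y0)/eqP : x0 \in A by rewrite AT memvf.
  by rewrite (negPf k0).
Qed.

End LieBasics.

(** * Root spaces *)

Section RootSpaces.
Context {K : numFieldType} {g : vectType K} {br : lieBracket g}.
Context {h : {vspace g}}.
Implicit Types (x y z : g) (M B : {vspace g}) (a b : dual h) (H : subvs_of h).

Lemma dualDE a b H : (a + b) H = a H + b H :> K. Proof. exact: add_lfunE. Qed.
Lemma dualNE a H : (- a) H = - a H :> K. Proof. exact: opp_lfunE. Qed.
Lemma dualBE a b H : (a - b) H = a H - b H :> K.
Proof. by rewrite dualDE dualNE. Qed.
Lemma dual0E H : (0 : dual h) H = 0 :> K. Proof. exact: zero_lfunE. Qed.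

Lemma dual_neq0 a : a != 0 -> exists H, a H != 0 :> K.
Proof.
by move/lfunPn => [H]; rewrite zero_lfunE => aH; exists H.
Qed.

Lemma root_spaceP a x :
  reflect (forall H, br (vsval H) x = (a H : K) *: x) (x \in root_space br a).
Proof.
have capP (s : seq (subvs_of h)) (F : subvs_of h -> {vspace g}) :
    reflect (forall i, i \in s -> x \in F i) (x \in (\bigcap_(i <- s) F i)%VS).
  elim: s => [|i s IH]; first by rewrite big_nil memvf; apply: ReflectT.
  rewrite big_cons memv_cap; apply: (iffP andP) => [[xi /IH xs] j|xs].
    by rewrite inE => /orP[/eqP->|/xs].
  split; first by apply: xs; rewrite mem_head.
  by apply/IH => j js; apply: xs; rewrite inE js orbT.
have kerE H : (x \in lker (ad br (vsval H) - (a H : K) *: \1%VF)) =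
    (br (vsval H) x == (a H : K) *: x).
  rewrite memv_ker add_lfunE opp_lfunE scale_lfunE id_lfunE adE subr_eq0 //.
apply: (iffP (capP _ _)) => [xP H|xP H _]; last by rewrite kerE xP.
rewrite {1 2}(coord_basis (vbasisP fullv) (memvf H)) !linear_sum br_suml scaler_suml.
apply: eq_bigr => i _; rewrite !linearZ /= brZl.
have : (vbasis {:subvs_of h})`_i \in vbasis {:subvs_of h} by rewrite mem_nth ?size_tuple.
by move/xP; rewrite kerE => /eqP ->; rewrite scalerA.
Qed.

Lemma br_root_space a b x y : x \in root_space br a -> y \in root_space br b ->
  br x y \in root_space br (a + b).
Proof.
move=> /root_spaceP xa /root_spaceP yb; apply/root_spaceP => H.
by rewrite br_br xa yb brZl brZr -scalerDl dualDE.
Qed.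

Lemma killing_root_space a b x y : a + b != 0 ->
  x \in root_space br a -> y \in root_space br b -> killing br x y = 0.
Proof.
move=> /dual_neq0[H]; rewrite dualDE => abH /root_spaceP xa /root_spaceP yb.
have := killing_brN br (vsval H) x y.
rewrite xa yb killingZl killingZr => /eqP; rewrite -subr_eq0 opprK -mulrDl.
by rewrite mulf_eq0 (negPf abH) => /eqP.
Qed.

Context (h_cartan : is_cartan br h).

Lemma cartan_abelian H1 H2 : br (vsval H1) (vsval H2) = 0.
Proof. by case: h_cartan => ab _ _; apply: ab; exact: subvsP. Qed.

Lemma cartan_maximal x : (forall H, br (vsval H) x = 0) -> x \in h.
Proof.
move=> xh; have [ab max _] := h_cartan.
have <- : (h + <[x]>)%VS = h; last by apply: (subvP (addvSr _ _)); exact: memv_line.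
apply: max; last exact: addvSl.
have xh' u : u \in h -> br u x = 0 by move=> uh; rewrite -(vsprojK uh) xh.
move=> _ _ /memv_addP[u uh [_ /vlineP[c ->] ->]] /memv_addP[v vh [_ /vlineP[d ->] ->]].
rewrite brDl !brDr !brZl !brZr bracketxx (ab u v) // xh' // (brC br x v) xh' //.
by rewrite oppr0 !scaler0 !addr0.
Qed.

Lemma root_space0 x : (x \in root_space br (0 : dual h)) = (x \in h).
Proof.
apply/root_spaceP/idP => [xP|xh H].
  by apply: cartan_maximal => H; rewrite xP dual0E scale0r.
by rewrite -(vsprojK xh) cartan_abelian dual0E scale0r.
Qed.

Lemma subvs_root_space0 H : vsval H \in root_space br (0 : dual h).
Proof. by rewrite root_space0 subvsP. Qed.

(* Induction on [\dim M]: an element of [h] acting on [M] without being scalar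
   splits [M] into smaller stable eigenspaces. *)
Lemma weight_ind M B : (forall H x, x \in M -> br (vsval H) x \in M) ->
  (forall a x, x \in M -> x \in root_space br a -> x \in B) -> (M <= B)%VS.
Proof.
have [n] := ubnP (\dim M); elim: n M => // n IH M ltMn hM MB.
have [scal|] := pselect (forall H, exists c, forall x, x \in M -> br (vsval H) x = c *: x).
  apply/subvP => x xM.
  have [->|x0] := eqVneq x 0; first exact: mem0v.
  have [i xi] : exists i, coord (vbasis {:g}) i x != 0.
    apply: contrapT => nex; case/eqP: x0.
    rewrite (coord_basis (vbasisP fullv) (memvf x)) big1 // => i _.
    have [->|xi] := eqVneq (coord (vbasis {:g}) i x) 0; first by rewrite scale0r.
    by case: nex; exists i.
  (* The scalars come from an existential, one for each H. Reading them as a quotient of coordinates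
     at a fixed nonzero coordinate of [x] shows that they are linear in H. *)
  have [|a aE] := @ex_lfun K (subvs_of h) K^o
      (fun H => coord (vbasis {:g}) i (br (vsval H) x) / coord (vbasis {:g}) i x).
    by move=> c H1 H2 /=; rewrite brDl brZl linearP mulrDl -mulrA.
  apply: (MB a) => //; apply/root_spaceP => H; rewrite aE.
  have [c cE] := scal H; rewrite cE // linearZ /= mulfK //.
move=> /existsNP[H0 nscal].
have dH : lf_diagonalizable (ad br (vsval H0)).
  by case: h_cartan => _ _; apply; exact: subvsP.
apply/subvP => v vM.
have [|s [w [wP ->]]] := diagonalizable_split dH _ vM.
  by move=> u uM; rewrite adE hM.
rewrite big_seq rpred_sum // => c cs; have [wM] := wP c cs; rewrite adE => wc.
pose Mc := (M :&: lker (ad br (vsval H0) - c *: \1%VF))%VS.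
have McP u : (u \in Mc) = (u \in M) && (br (vsval H0) u == c *: u).
  by rewrite memv_cap memv_ker add_lfunE opp_lfunE scale_lfunE id_lfunE adE subr_eq0.
have wMc : w c \in Mc by rewrite McP wM wc eqxx.
apply: (subvP _ _ wMc); apply: IH.
- rewrite ltnS in ltMn; apply: leq_trans ltMn; rewrite ltnNge; apply/negP => leM.
  have eM : Mc = M by apply/eqP; rewrite eqEdim capvSl leM.
  by apply: nscal; exists c => x; rewrite -eM McP => /andP[_ /eqP].
- move=> H x; rewrite !McP => /andP[xM /eqP xc]; rewrite hM //=.
  by rewrite br_br cartan_abelian br0l add0r xc linearZ.
- by move=> a x; rewrite McP => /andP[xM _]; exact: MB.
Qed.

Lemma weight_ind_pred (Q P : g -> Prop) :
  Q 0 -> (forall c u v, Q u -> Q v -> Q (c *: u + v)) ->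
  P 0 -> (forall c u v, P u -> P v -> P (c *: u + v)) ->
  (forall H x, Q x -> Q (br (vsval H) x)) ->
  (forall a x, Q x -> x \in root_space br a -> P x) ->
  forall x, Q x -> P x.
Proof.
move=> Q0 QL P0 PL hQ QP x Qx.
have [M MP] := ex_vspace Q0 QL; have [B BP] := ex_vspace P0 PL.
apply/BP; apply: (subvP (@weight_ind M B _ _)); last exact/MP.
  by move=> H y /MP Qy; apply/MP/hQ.
by move=> a y /MP Qy ya; apply/BP/(QP a).
Qed.

Lemma weight_ind_full (P : g -> Prop) :
  P 0 -> (forall c u v, P u -> P v -> P (c *: u + v)) ->
  (forall a x, x \in root_space br a -> P x) -> forall x, P x.
Proof.
move=> P0 PL PR x; apply: (@weight_ind_pred (fun=> True)) => //.
by move=> a y _; exact: PR.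
Qed.

(** Not a predicate: roots are forms on the type [subvs_of h], and this sends an element of [g]
    there. It is meant for [x] in [h]. *)
Definition in_cartan x : subvs_of h := vsproj h x.

Lemma cartan_act b x y : x \in root_space br (0 : dual h) ->
  y \in root_space br b -> br x y = (b (in_cartan x) : K) *: y.
Proof.
by rewrite root_space0 => xh /root_spaceP <-; rewrite vsprojK.
Qed.

Lemma iter_root_space n a b x y : x \in root_space br a ->
  y \in root_space br b -> iter n (br x) y \in root_space br (b + a *+ n).
Proof.
move=> xa yb; elim: n => [|n IH]; first by rewrite addr0.
by rewrite mulrS addrCA; exact: br_root_space.
Qed.

Context (Delta : seq (dual h)) (DeltaP : lists_roots br Delta).

Lemma mem_roots b x : x \in root_space br b -> x != 0 -> b != 0 -> b \in Delta.
Proof.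
move=> xb x0 b0; rewrite DeltaP /is_root b0 /=; apply: contraNneq x0 => rb0.
by rewrite rb0 memv0 in xb.
Qed.

Lemma root_neq0 b : b \in Delta -> b != 0.
Proof. by rewrite DeltaP => /andP[]. Qed.

Lemma root_vector b : b \in Delta -> exists2 x, x \in root_space br b & x != 0.
Proof.
rewrite DeltaP => /andP[_ rb]; exists (vpick (root_space br b)); first exact: memv_pick.
by rewrite vpick0.
Qed.

(** The weights [b + a *+ n] are distinct, and nonzero vectors have their weights in [0 :: Delta];
    [size Delta + 2] of them are too many. *)
Lemma iter_root_vector_eq0 a b x y : a != 0 -> x \in root_space br a ->
  y \in root_space br b -> exists n, iter n (br x) y = 0.
Proof.
move=> a0 xa yb; apply: contrapT => nex.
pose s := [seq b + a *+ n | n <- iota 0 (size Delta).+2].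
have us : uniq s.
  rewrite map_inj_in_uniq ?iota_uniq // => i j _ _ /addrI/eqP.
  rewrite -!(scaler_nat _ a) -subr_eq0 -scalerBl scaler_eq0 (negPf a0) orbF.
  by rewrite subr_eq0 eqr_nat => /eqP.
have : {subset s <= 0 :: Delta}.
  move=> _ /mapP[n _ ->]; rewrite inE; case: eqVneq => //= bn.
  apply: mem_roots bn; first exact: iter_root_space xa yb.
  by apply/eqP => y0; apply: nex; exists n.
by move/(uniq_leq_size us); rewrite size_map size_iota /= ltnn.
Qed.

Context (nd : forall x, (forall y, killing br x y = 0) -> x = 0).

(** A vector of weight [a] is orthogonal to every weight space except that of [- a], so the form
    must be nonzero there. *)
Lemma killing_root_nondegenerate a x : x \in root_space br a -> x != 0 ->
  exists2 y, y \in root_space br (- a) & killing br x y = 1.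
Proof.
move=> xa x0; apply: contrapT => nex; case/eqP: x0; apply: nd.
apply: weight_ind_full.
- by rewrite linear0.
- by move=> c u v ku kv; rewrite linearD /= killingZr ku kv mulr0 addr0.
move=> b y yb; have [b0|b0] := eqVneq (a + b) 0; last exact: killing_root_space b0 xa yb.
have eb : b = - a by apply/eqP; rewrite -addr_eq0 addrC b0.
rewrite {}eb in yb b0.
have [//|k0] := eqVneq (killing br x y) 0; case: nex.
exists ((killing br x y)^-1 *: y); first by rewrite memvZ.
by rewrite killingZr mulVf.
Qed.

Lemma br_opp_root_space a e f : e \in root_space br a -> f \in root_space br (- a) ->
  br e f \in root_space br (0 : dual h).
Proof. by move=> ea fa; rewrite -(subrr a); exact: br_root_space. Qed.

(** So [br e f] is [killing br e f] times the element of [h] representing [a] under the form. *)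
Lemma killing_coroot a e f H : e \in root_space br a -> f \in root_space br (- a) ->
  killing br (br e f) (vsval H) = a H * killing br e f.
Proof.
move=> ea /root_spaceP fa.
by rewrite killing_br brC fa dualNE scaleNr opprK killingZr.
Qed.

Lemma last_nonzero_iter (f : g -> g) x : x != 0 -> (exists n, iter n f x = 0) ->
  exists n, iter n f x != 0 /\ iter n.+1 f x = 0.
Proof.
move=> x0 [n0 fn0].
have ex : exists n, iter n f x == 0 by exists n0; rewrite fn0.
case: (ex_minnP ex) => -[|n] /eqP fn min; first by rewrite /= in fn; rewrite fn eqxx in x0.
by exists n; split => //; apply/negP => /min; rewrite ltnn.
Qed.

(* If [a] vanished on [br e f], the three elements would span a Heisenberg
   algebra acting on [g] with nilpotent [e], [f], so its center would act by 0. *)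
Lemma coroot_neq0 a e f : a != 0 -> e \in root_space br a ->
  f \in root_space br (- a) -> killing br e f = 1 ->
  a (in_cartan (br e f)) != 0 :> K.
Proof.
move=> a0 ea fa kef; apply/eqP => at0.
have t0 := br_opp_root_space ea fa.
have ak n : (a *+ n) (in_cartan (br e f)) = 0 :> K.
  by elim: n => [|n IH]; rewrite ?dual0E // mulrS dualDE IH at0 addr0.
have zero b x : x \in root_space br b -> x != 0 -> b (in_cartan (br e f)) = 0 :> K.
  move=> xb x0.
  have [k [y0 ey0]] := last_nonzero_iter x0 (iter_root_vector_eq0 a0 ea xb).
  set y := iter k _ _ in y0 ey0; rewrite /= -/y in ey0.
  have yb : y \in root_space br (b + a *+ k) by exact: iter_root_space.
  set c := (b _ : K).
  have tE n : br (br e f) (iter n (br f) y) = c *: iter n (br f) y.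
    rewrite (cartan_act t0 (iter_root_space n fa yb)) mulNrn !dualDE dualNE !ak.
    by rewrite oppr0 !addr0.
  (* The weight of [br e f] is constant along the string, since [a] vanishes on it. At the first
     power of [f] that kills [y] this relation forces [c = 0]. For [n = 0] the predecessor is
     harmless, the coefficient being 0. *)
  have step n : br e (iter n (br f) y) = (n%:R * c) *: iter n.-1 (br f) y.
    elim: n => [|n IH]; first by rewrite ey0 mul0r scale0r.
    rewrite [iter n.+1 _ _]/= br_br tE IH brZr -natr1 mulrDl mul1r scalerDl addrC.
    by case: n {IH} => [|n] //=; rewrite !mul0r !scale0r.
  have na0 : - a != 0 by rewrite oppr_eq0.
  have [n [fn0 fSn0]] := last_nonzero_iter y0 (iter_root_vector_eq0 na0 fa yb).
  have /esym/eqP := step n.+1; rewrite fSn0 br0r scaler_eq0 (negPf fn0) orbF.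
  by rewrite mulf_eq0 pnatr_eq0 => /eqP.
have tc y : br (br e f) y = 0.
  move: y; apply: weight_ind_full => [|c u v|b x xb]; first by rewrite br0r.
    by move=> tu tv; rewrite brDr brZr tu tv scaler0 addr0.
  have [->|x0] := eqVneq x 0; first by rewrite br0r.
  by rewrite (cartan_act t0 xb) (zero _ _ xb x0) scale0r.
have [H aH] := dual_neq0 a0.
have := killing_coroot H ea fa; rewrite kef mulr1 killingE /trace_in big1.
  by move/esym/eqP; rewrite (negPf aH).
by move=> i _; rewrite tc linear0.
Qed.

Lemma cartan_eq0 x : x \in root_space br (0 : dual h) ->
  (forall H, killing br x (vsval H) = 0) -> x = 0.
Proof.
move=> x0 kx; apply/eqP; apply: contraT => xn0.
have [y] := killing_root_nondegenerate x0 xn0; rewrite oppr0 root_space0 => yh.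
by rewrite -(vsprojK yh) kx => /eqP; rewrite eq_sym oner_eq0.
Qed.

(* An [e'] in the root space of [a] with [killing e' f = 0] would be a vector of
   lowest weight 2 for the triple [e], [br e f], [f]. *)
Lemma root_space_line a x y : a != 0 -> x \in root_space br a -> x != 0 ->
  y \in root_space br a -> exists c, y = c *: x.
Proof.
move=> a0 xa x0 ya.
have [f fa kxf] := killing_root_nondegenerate xa x0.
exists (killing br y f); apply/eqP; rewrite -subr_eq0.
set e' := y - _.
have e'a : e' \in root_space br a by rewrite memvB ?memvZ.
have ke' : killing br e' f = 0 by rewrite killingBl killingZl kxf mulr1 subrr.
have e'f : br e' f = 0.
  by apply: (cartan_eq0 (br_opp_root_space e'a fa)) => H; rewrite (killing_coroot _ e'a fa) ke' mulr0.
apply: contraT => e'0.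
have t0 := br_opp_root_space xa fa.
have c0 := coroot_neq0 a0 xa fa kxf; set c := (a _ : K) in c0.
have an n : (a *+ n) (in_cartan (br x f)) = n%:R * c :> K.
  by elim: n => [|n IH]; rewrite ?dual0E ?mul0r // mulrS dualDE IH -natr1 mulrDl mul1r addrC.
(* The coefficient is [- n (n + 1) / 2] times [c], nonzero for [n > 0]; so the string of [e'] under
   [x] could never end. *)
have step n : br f (iter n (br x) e') =
    - (\sum_(k < n) k.+1%:R * c) *: iter n.-1 (br x) e'.
  elim: n => [|n IH]; first by rewrite big_ord0 oppr0 scale0r brC e'f oppr0.
  rewrite [iter n.+1 _ _]/= br_br (brC br f x) brNl.
  rewrite (cartan_act t0 (iter_root_space n xa e'a)) IH brZr big_ord_recr /=.
  rewrite opprD scalerDl addrC dualDE an -/c.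
  congr (_ + _); first by case: n {IH} => [|n] //=; rewrite big_ord0 oppr0 !scale0r.
  by rewrite -scaleNr -[X in X + n%:R * c]mul1r -mulrDl nat1r.
have [n [en0 eSn0]] := last_nonzero_iter e'0 (iter_root_vector_eq0 a0 xa e'a).
have /esym/eqP := step n.+1; rewrite eSn0 br0r scaler_eq0 (negPf en0) orbF.
rewrite oppr_eq0 -mulr_suml mulf_eq0 (negPf c0) orbF -natr_sum pnatr_eq0.
by rewrite big_ord_recr /= addnS.
Qed.

(** * Generation by simple root spaces *)

(** Bases of the intersections of [M] with the weight spaces span [M] by [weight_ind]; a free
    subfamily is extracted from their concatenation, whose members are still weight vectors. *)
Lemma ex_weight_basis M : (forall H x, x \in M -> br (vsval H) x \in M) ->
  exists2 s : seq g, free s /\ <<s>>%VS = M &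
    forall x, x \in s -> exists b : dual h, x \in root_space br b.
Proof.
move=> hM.
pose s := flatten [seq (vbasis (M :&: root_space br b)%VS : seq g) | b <- 0 :: Delta].
have sP x : x \in s -> exists2 b : dual h, x \in M & x \in root_space br b.
  move=> /flattenP[_ /mapP[b _ ->]] /vbasis_mem; rewrite memv_cap => /andP[xM xb].
  by exists b.
have [t ts [ft et]] := span_extract_basis s.
exists t; last by move=> x /ts/sP[b _ xb]; exists b.
split => //; rewrite et; apply/eqP; rewrite eqEsubv; apply/andP; split.
  by apply/span_subvP => x /sP[].
apply: (weight_ind hM) => b x xM xb.
have [->|x0] := eqVneq x 0; first exact: mem0v.
have bD : b \in 0 :: Delta.
  by rewrite inE; case: eqVneq => //= b0; exact: mem_roots xb x0 b0.
have : x \in (M :&: root_space br b)%VS by rewrite memv_cap xM.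
rewrite -(span_basis (vbasisP (M :&: root_space br b)%VS)); apply: subvP.
apply: sub_span => y yb; apply/flattenP; exists (tval (vbasis (M :&: root_space br b)%VS)) => //.
by apply/mapP; exists b.
Qed.

Section Base.
Context (r : nat) (a : 'I_r -> dual h) (E : 'I_r -> subvs_of h).
Context (aE : forall i j, a i (E j) = (i == j)%:R :> K).
Context (aD : forall i, a i \in Delta).
Context (sgn : forall b, b \in Delta -> exists c : 'I_r -> nat,
  b = \sum_i a i *+ c i \/ b = - \sum_i a i *+ c i).

Lemma sum_simple_roots (c : 'I_r -> nat) j : (\sum_i a i *+ c i) (E j) = (c j)%:R :> K.
Proof.
rewrite sum_lfunE (bigD1 j) //= big1 => [|i ij].
  by rewrite -scaler_nat scale_lfunE aE eqxx addr0; exact: mulr1.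
by rewrite -scaler_nat scale_lfunE aE (negPf ij); exact: mulr0.
Qed.

Lemma root_signs b : b \in Delta ->
  (forall i, 0 <= (b (E i) : K)) \/ (forall i, (b (E i) : K) <= 0).
Proof.
move=> /sgn[c [->|->]]; [left|right] => i.
  by rewrite sum_simple_roots ler0n.
by rewrite dualNE sum_simple_roots oppr_le0 ler0n.
Qed.

Lemma cartan_simple_eq0 x : x \in root_space br (0 : dual h) ->
  (forall i, a i (in_cartan x) = 0 :> K) -> x = 0.
Proof.
move=> x0 ax.
have bx b : b \in Delta -> b (in_cartan x) = 0 :> K.
  have sum0 (c : 'I_r -> nat) : (\sum_i a i *+ c i) (in_cartan x) = 0 :> K.
    by rewrite sum_lfunE big1 // => i _; rewrite -scaler_nat scale_lfunE ax; exact: mulr0.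
  by move=> /sgn[c [->|->]]; rewrite ?dualNE sum0 ?oppr0.
have tc y : br x y = 0.
  move: y; apply: weight_ind_full => [|c u v|b y yb]; first by rewrite br0r.
    by move=> tu tv; rewrite brDr brZr tu tv scaler0 addr0.
  rewrite (cartan_act x0 yb).
  have [->|y0] := eqVneq y 0; first by rewrite scaler0.
  have [->|b0] := eqVneq b 0; first by rewrite dual0E scale0r.
  by rewrite bx ?scale0r // (mem_roots yb).
by apply: nd => y; rewrite killingE /trace_in big1 // => i _; rewrite tc linear0.
Qed.

Lemma cartan_expand x : x \in root_space br (0 : dual h) ->
  x = \sum_i (a i (in_cartan x) : K) *: vsval (E i).
Proof.
move=> x0; apply/eqP; rewrite -subr_eq0; apply/eqP; apply: cartan_simple_eq0.
  by rewrite memvB // rpred_sum // => i _; rewrite memvZ // subvs_root_space0.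
move=> j; rewrite /in_cartan linearB linear_sum /= linearB linear_sum /=.
rewrite (bigD1 j) //= big1 => [|i ij].
  by rewrite !linearZ /= vsvalK aE eqxx addr0 [_ *: _]mulr1 subrr.
by rewrite !linearZ /= vsvalK aE eq_sym (negPf ij); exact: mulr0.
Qed.

(** The sum of the fundamental coweights: its value at a root is the height of the root. *)
Let rho : subvs_of h := \sum_i E i.

Lemma simple_root_rho i : a i rho = 1 :> K.
Proof.
rewrite linear_sum (bigD1 i) //= big1 ?aE ?eqxx ?addr0 // => j ji.
by rewrite aE eq_sym (negPf ji).
Qed.

(** The weight [a i - a j] has coefficients of both signs, so it is not a root. *)
Lemma br_simple_opp i j e f : i != j -> e \in root_space br (a i) ->
  f \in root_space br (- a j) -> br e f = 0.
Proof.
move=> ij ei fj; apply/eqP; apply: contraT => ef0.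
have efr := br_root_space ei fj.
have v1 : (a i - a j) (E i) = 1 :> K by rewrite dualBE !aE eqxx eq_sym (negPf ij) subr0.
have v2 : (a i - a j) (E j) = -1 :> K by rewrite dualBE !aE eqxx (negPf ij) sub0r.
have n0 : a i - a j != 0.
  by apply/eqP => e0; move: v1; rewrite e0 dual0E => /esym/eqP; rewrite oner_eq0.
case: (root_signs (mem_roots efr ef0 n0)) => [/(_ j)|/(_ i)].
  by rewrite v2 oppr_ge0 ler10.
by rewrite v1 ler10.
Qed.

(* The trace of [rho] on the submodule generated by a singular vector [y] is 0,
   because [rho] is a combination of the brackets [br e_i f_i]; but the weights
   of that submodule all take negative values at [rho]. *)
Lemma no_negative_singular_vector b y : y \in root_space br b -> y != 0 ->
  0 < (- b rho : K) -> ~ (forall i e, e \in root_space br (a i) -> br e y = 0).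
Proof.
move=> yb y0 b_lt0 ye0.
(* Only [h] and the negative simple root spaces generate; stability under the positive simple root
   spaces is deduced in [eM]. The trace argument needs both. *)
pose S (f : g -> g) := (exists H, f = br (vsval H)) \/
  (exists i z, z \in root_space br (- a i) /\ f = br z).
have [M [yM SM minM]] := ex_smallest_stable S y.
have hM H x : x \in M -> br (vsval H) x \in M by move=> xM; apply: SM => //; left; exists H.
have fM i f x : f \in root_space br (- a i) -> x \in M -> br f x \in M.
  by move=> fi xM; apply: SM => //; right; exists i, f.
have eM i e x : e \in root_space br (a i) -> x \in M -> br e x \in M.
  (* The vectors of [M] sent into [M] by all positive simple root vectors. They include [y] and form
     a stable subspace, because a bracket of opposite simple root vectors lies in [h] or is 0;
     minimality of [M] concludes. *)
  have [||B BP] := @ex_vspace K g (fun x => x \in M /\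
      forall i e, e \in root_space br (a i) -> br e x \in M).
  - by split=> [|j z _]; rewrite ?br0r mem0v.
  - move=> c u v [uM uE] [vM vE]; split; first by rewrite memvD ?memvZ.
    by move=> j z zj; rewrite brDr brZr memvD ?memvZ ?(uE j) ?(vE j).
  have MB : (M <= B)%VS.
    apply: minM; first by apply/BP; split=> // j z zj; rewrite (ye0 j) ?mem0v.
    move=> f v Sf /BP[vM vE]; apply/BP; split; first exact: SM.
    move=> j z zj; case: Sf => [[H ->]|[k [w [wk ->]]]]; rewrite br_br memvD //.
    - by apply: (vE j); rewrite -[a j]addr0; apply: br_root_space => //; exact: subvs_root_space0.
    - exact/hM/(vE j).
    - have [jk|jk] := eqVneq j k; last by rewrite (br_simple_opp jk zj wk) br0l mem0v.
      have zw0 : br z w \in h.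
        by rewrite -root_space0 jk in zj *; exact: br_opp_root_space zj wk.
      by rewrite -(vsprojK zw0) hM.
    - by apply: (fM k) => //; exact: (vE j).
  by move=> ei /(subvP MB)/BP[_ /(_ i e ei)].
have neg c x : x \in M -> x != 0 -> x \in root_space br c -> 0 < (- c rho : K).
  (* Negativity is expressed by orthogonality to all weight spaces whose weight is not positive at
     [rho]. The order of [K] is partial, hence a negated strict inequality. *)
  pose P x := forall d z, z \in root_space br d -> ~~ (0 < (d rho : K)) ->
    killing br x z = 0.
  have [||B BP] := @ex_vspace K g P.
  - by move=> d z _ _; rewrite killing0l.
  - move=> k u v Pu Pv d z zd dr; rewrite killingDl killingZl.
    by rewrite (Pu d) // (Pv d) // mulr0 addr0.
  have MB : (M <= B)%VS.
    apply: minM.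
      apply/BP => d z zd dr; apply: (killing_root_space _ yb zd); apply: contraNneq dr => bd0.
      by rewrite -(addKr b d) bd0 addr0 dualNE.
    move=> f v Sf /BP Pv; apply/BP => d z zd dr.
    case: Sf => [[H ->]|[i [w [wi ->]]]]; rewrite killing_brN.
      by move/root_spaceP: (zd) => ->; rewrite killingZr (Pv d) // mulr0 oppr0.
    rewrite (Pv (- a i + d)) ?oppr0 //; first exact: br_root_space.
    rewrite dualDE dualNE simple_root_rho; apply: contra dr => lt0.
    by rewrite -(subrK 1 (d rho)) addrC ltr_wpDl ?ler01 // addrC.
  move=> /(subvP MB)/BP Px x0 xc.
  have [z zc kxz] := killing_root_nondegenerate xc x0.
  rewrite -dualNE; apply: contraT => /(Px _ _ zc); rewrite kxz => /eqP.
  by rewrite oner_eq0.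
have [s [fs es] sP] := ex_weight_basis hM.
pose t := in_tuple s.
have tM (i : 'I_(size s)) : t`_i \in M by rewrite -es memv_span ?mem_nth.
have stab f : (forall x, x \in M -> br f x \in M) ->
    forall v, v \in <<t>>%VS -> ad br f v \in <<t>>%VS.
  by move=> fst v; rewrite /= es adE => /fst.
have tr0 i e f : e \in root_space br (a i) -> f \in root_space br (- a i) ->
    trace_in t (br (br e f)) = 0.
  move=> ei fi.
  have := @trace_inC _ _ _ t (ad br e) (ad br f) fs
    (stab _ (fun x => @eM i _ x ei)) (stab _ (fun x => @fM i _ x fi)).
  rewrite /trace_in => /eqP; rewrite -subr_eq0 -sumrB => /eqP tr; rewrite -[RHS]tr.
  by apply: eq_bigr => k _ /=; rewrite !adE br_brl linearB.
have /choice[ef efP] i : exists p : g * g,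
    [/\ p.1 \in root_space br (a i), p.2 \in root_space br (- a i)
      & killing br p.1 p.2 = 1].
  have [e ei e0] := root_vector (aD i).
  by have [f fi kef] := killing_root_nondegenerate ei e0; exists (e, f).
(* The [br (ef i).1 (ef i).2] represent the simple roots under the form, so they are dual to the
   [E i]; this explains the coefficients. *)
have rhoE : vsval rho = \sum_i killing br (vsval rho) (vsval (E i)) *: br (ef i).1 (ef i).2.
  apply/eqP; rewrite -subr_eq0; apply/eqP; apply: cartan_eq0 => [|H].
    rewrite memvB ?subvs_root_space0 // rpred_sum // => i _; rewrite memvZ //.
    by have [ei fi _] := efP i; exact: br_opp_root_space ei fi.
  rewrite killingBl killing_suml {1}(cartan_expand (subvs_root_space0 H)) linear_sum -sumrB big1 // => i _ /=.
  have [ei fi kef] := efP i.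
  by rewrite killingZr killingZl (killing_coroot _ ei fi) kef mulr1 /in_cartan vsvalK mulrC subrr.
have trho0 : trace_in t (br (vsval rho)) = 0.
  transitivity (\sum_i killing br (vsval rho) (vsval (E i)) * trace_in t (br (br (ef i).1 (ef i).2))).
    rewrite {1}rhoE /trace_in; under [RHS]eq_bigr do rewrite mulr_sumr.
    rewrite exchange_big /=; apply: eq_bigr => k _; rewrite br_suml linear_sum /=.
    by apply: eq_bigr => i _; rewrite brZl linearZ.
  by rewrite big1 // => i _; have [ei fi _] := efP i; rewrite (tr0 i) ?mulr0.
have t0 (i : 'I_(size s)) : t`_i != 0.
  by apply: (free_not0 fs); rewrite mem_nth.
have trho (i : 'I_(size s)) : 0 < - coord t i (br (vsval rho) t`_i).
  have [c tc] := sP t`_i (mem_nth _ (ltn_ord i)).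
  move/root_spaceP: (tc) => ->; rewrite linearZ /= coord_free // eqxx mulr1.
  exact: neg (tM i) (t0 i) tc.
have sz : (0 < size s)%N.
  rewrite lt0n size_eq0; apply: contraNneq y0 => s0.
  by move: yM; rewrite -es s0 span_nil memv0.
have sum0 : \sum_(i < size s) - coord t i (br (vsval rho) t`_i) = 0.
  by rewrite sumrN; move: trho0; rewrite /trace_in => ->; rewrite oppr0.
have := trho (Ordinal sz).
by rewrite (psumr_eq0P (fun i _ => ltW (trho i)) sum0) // ltxx.
Qed.

Lemma positive_root_sum b : b \in Delta -> (forall i, 0 <= (b (E i) : K)) ->
  exists2 c : 'I_r -> nat, b = \sum_i a i *+ c i & (0 < \sum_i c i)%N.
Proof.
move=> bD b_ge0.
have [c bE] : exists c : 'I_r -> nat, b = \sum_i a i *+ c i.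
  have [c [bE|bE]] := sgn bD; first by exists c.
  exists (fun=> 0%N); rewrite bE !big1 ?oppr0 // => i _.
  have := b_ge0 i; rewrite bE dualNE sum_simple_roots oppr_ge0 lern0 => /eqP ->.
  by rewrite mulr0n.
exists c => //; rewrite lt0n; apply: contraNneq (root_neq0 bD) => /eqP.
rewrite sum_nat_eq0 => /forallP c0; rewrite bE big1 // => i _.
by have /eqP -> := implyP (c0 i) isT; rewrite mulr0n.
Qed.

Lemma sum_rho (c : 'I_r -> nat) : (\sum_i a i *+ c i) rho = (\sum_i c i)%N%:R :> K.
Proof.
rewrite /rho linear_sum natr_sum; apply: eq_bigr => i _.
exact: sum_simple_roots.
Qed.

(** Otherwise a vector [f] of weight [- b] would be killed by all simple root vectors, contrary to
    [no_negative_singular_vector]. If [br e f] is nonzero, a partner [y] of it under the form has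
    weight [b - a i], and invariance gives [br e y != 0]. *)
Lemma positive_root_descent b : b \in Delta -> (forall i, 0 <= (b (E i) : K)) ->
  (forall i, b != a i) ->
  exists i e y, [/\ e \in root_space br (a i), y \in root_space br (b - a i),
    b - a i \in Delta & br e y != 0].
Proof.
move=> bD b_ge0 bna; apply: contrapT => nex.
have [z zb z0] := root_vector bD.
have [f fb kzf] := killing_root_nondegenerate zb z0.
have f0 : f != 0.
  by apply/eqP => f0; move: kzf; rewrite f0 linear0 => /esym/eqP; rewrite oner_eq0.
apply: (no_negative_singular_vector fb f0).
  have [c -> c_gt0] := positive_root_sum bD b_ge0.
  by rewrite dualNE opprK sum_rho ltr0n.
move=> i e ei; apply/eqP; apply: contraT => ef0; case: nex.
have [y yb key] := killing_root_nondegenerate (br_root_space ei fb) ef0.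
rewrite opprD opprK addrC in yb.
have ey0 : br e y != 0.
  apply/eqP => ey0; move: key; rewrite killing_brN ey0 linear0 oppr0 => /esym/eqP.
  by rewrite oner_eq0.
exists i, e, y; split => //; apply: mem_roots yb _ _; last by rewrite subr_eq0.
by apply: contraNneq ey0 => ->; rewrite br0r.
Qed.

(** * The grading by the coefficient of one simple root *)

Section Graded.
Context (q : 'I_r).

(** The grading as eigenspaces of the coweight [E q]; [gradingP] identifies them with [grading]. *)
Definition in_degree (k : K) x : Prop := br (vsval (E q)) x = k *: x.

Lemma in_degree0 k : in_degree k 0.
Proof. by rewrite /in_degree br0r scaler0. Qed.

Lemma in_degreeP k c u v : in_degree k u -> in_degree k v -> in_degree k (c *: u + v).
Proof.
by rewrite /in_degree brDr brZr => -> ->; rewrite scalerDr !scalerA mulrC.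
Qed.

Lemma in_degree_br j k x y : in_degree j x -> in_degree k y -> in_degree (j + k) (br x y).
Proof. by rewrite /in_degree br_br => -> ->; rewrite brZl brZr -scalerDl. Qed.

Lemma in_degree_root b x : x \in root_space br b -> in_degree (b (E q)) x.
Proof. by move/root_spaceP/(_ (E q)). Qed.

Lemma in_degree_uniq j k x : in_degree j x -> in_degree k x -> x != 0 -> j = k.
Proof.
rewrite /in_degree => -> /eqP; rewrite -subr_eq0 -scalerBl scaler_eq0.
by move=> /orP[|->//]; rewrite subr_eq0 => /eqP.
Qed.

Lemma in_degree_cartan k H x : in_degree k x -> in_degree k (br (vsval H) x).
Proof.
move=> xk; rewrite -[k]add0r; apply: in_degree_br xk.
by rewrite /in_degree cartan_abelian scale0r.
Qed.

Lemma in_degree_ind k (P : g -> Prop) :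
  P 0 -> (forall c u v, P u -> P v -> P (c *: u + v)) ->
  (forall b x, x \in root_space br b -> b (E q) = k :> K -> P x) ->
  forall x, in_degree k x -> P x.
Proof.
move=> P0 PL PR; apply: weight_ind_pred => //.
- exact: in_degree0.
- by move=> c u v; exact: in_degreeP.
- by move=> H x; exact: in_degree_cartan.
move=> b x xk xb; have [->//|x0] := eqVneq x 0.
apply: (PR b) => //; exact: in_degree_uniq (in_degree_root xb) xk x0.
Qed.

Lemma root_degree_positive b : b \in Delta -> 0 < (b (E q) : K) ->
  forall i, 0 <= (b (E i) : K).
Proof.
move=> /root_signs[//|/(_ q) b_le0] b_gt0.
by have := lt_le_trans b_gt0 b_le0; rewrite ltxx.
Qed.

(** Induction on the height: [positive_root_descent] writes a root vector, up to a scalar, as a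
    bracket with a vector for some [a i]. If [i] is [q] the degree drops and the third hypothesis
    applies; otherwise that vector has degree 0 and the height drops within the same degree. *)
Lemma degree_generated (B : {vspace g}) (k : nat) : (0 < k)%N ->
  (k = 1%N -> forall x, x \in root_space br (a q) -> x \in B) ->
  (forall e x b, e \in root_space br (a q) -> x \in root_space br b ->
     b (E q) = k.-1%:R :> K -> br e x \in B) ->
  (forall x y, in_degree 0 x -> y \in B -> br x y \in B) ->
  forall x, in_degree k%:R x -> x \in B.
Proof.
move=> k_gt0 B1 Bk B0.
have key n b : b \in Delta -> b (E q) = k%:R :> K -> b rho = n%:R :> K ->
    forall x, x \in root_space br b -> x \in B.
  elim: n b => [|n IH] b bD bq brho x xb.
    have [|c bE] := positive_root_sum bD; first by apply: root_degree_positive; rewrite // bq ltr0n.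
    by move: brho; rewrite bE sum_rho => /eqP; rewrite pnatr_eq0 => /eqP ->.
  have b_ge0 : forall i, 0 <= (b (E i) : K) by apply: root_degree_positive; rewrite // bq ltr0n.
  have [[i bi]|bna] := pselect (exists i, b = a i).
    have iq : i = q.
      apply/eqP; apply: contraT => niq; move: bq; rewrite bi aE (negPf niq) => /esym/eqP.
      by rewrite pnatr_eq0 -leqn0 leqNgt k_gt0.
    apply: B1; last by rewrite -iq -bi.
    by move/eqP: bq; rewrite bi iq aE eqxx eqr_nat => /eqP.
  have [|i [e [y [ei yb bi ey0]]]] := positive_root_descent bD b_ge0.
    by move=> i; apply/eqP => bi; apply: bna; exists i.
  have eyb := br_root_space ei yb; rewrite addrC subrK in eyb.
  have [c ->] := root_space_line (root_neq0 bD) eyb ey0 xb.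
  rewrite memvZ //; have [iq|iq] := eqVneq i q.
    rewrite iq in ei yb; apply: (Bk _ _ _ ei yb).
    by rewrite dualBE bq aE eqxx -{1}(prednK k_gt0) -natr1 addrK.
  apply: B0; first by have := in_degree_root ei; rewrite aE (negPf iq).
  apply: IH yb => //; first by rewrite dualBE bq aE (negPf iq) subr0.
  by rewrite dualBE brho simple_root_rho -natr1 addrK.
apply: in_degree_ind => [|c u v uB vB|b x xb bq]; first exact: mem0v.
  by rewrite memvD ?memvZ.
have [->|x0] := eqVneq x 0; first exact: mem0v.
have bD : b \in Delta.
  apply: mem_roots xb x0 _; apply/eqP => b0; move: bq; rewrite b0 dual0E => /esym/eqP.
  by rewrite pnatr_eq0 -leqn0 leqNgt k_gt0.
have [|c bE _] := positive_root_sum bD; first by apply: root_degree_positive; rewrite // bq ltr0n.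
by apply: (key (\sum_i c i)%N b) => //; rewrite {1}bE sum_rho.
Qed.

Lemma degree1_generated (B : {vspace g}) :
  (forall x, x \in root_space br (a q) -> x \in B) ->
  (forall x y, in_degree 0 x -> y \in B -> br x y \in B) ->
  forall x, in_degree 1 x -> x \in B.
Proof.
move=> B1 B0; apply: (@degree_generated B 1) => // e x b eq xb b0.
rewrite brC memvN; apply: B0; last exact: B1.
by have := in_degree_root xb; rewrite b0.
Qed.

Lemma degreeS_generated (B : {vspace g}) (k : nat) :
  (forall x y, in_degree 1 x -> in_degree k.+1%:R y -> br x y \in B) ->
  (forall x y, in_degree 0 x -> y \in B -> br x y \in B) ->
  forall x, in_degree k.+2%:R x -> x \in B.
Proof.
move=> B1 B0; apply: degree_generated => // e x b eq xb bk; apply: B1.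
  by have := in_degree_root eq; rewrite aE eqxx.
by have := in_degree_root xb; rewrite bk.
Qed.

End Graded.
End Base.

(** * The Levi subalgebra acting in degree -1 *)

Lemma opp_root b : b \in Delta -> - b \in Delta.
Proof.
move=> bD; have [x xb x0] := root_vector bD.
have [y yb kxy] := killing_root_nondegenerate xb x0.
apply: mem_roots yb _ _; last by rewrite oppr_eq0 root_neq0.
by apply/eqP => y0; move: kxy; rewrite y0 linear0 => /esym/eqP; rewrite oner_eq0.
Qed.

Section Levi.
Context (r : nat) (a : 'I_r -> dual h) (E : 'I_r -> subvs_of h) (q : 'I_r).
Context (aE : forall i j, a i (E j) = (i == j)%:R :> K).
Context (aD : forall i, a i \in Delta).
Context (sgn : forall b, b \in Delta -> exists c : 'I_r -> nat,
  b = \sum_i a i *+ c i \/ b = - \sum_i a i *+ c i).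

Local Notation deg := (in_degree E q).
Let rho : subvs_of h := \sum_i E i.

(** The opposite base, with opposite coweights, satisfies the same hypotheses; results in degrees 1
    and 2 become results in degrees -1 and -2. *)
Let aE' i j : (- a i) (- E j) = (i == j)%:R :> K.
Proof. by rewrite dualNE (linearN (a i)) opprK; exact: aE. Qed.

Let aD' i : - a i \in Delta. Proof. exact: opp_root. Qed.

Let sgn' b : b \in Delta -> exists c : 'I_r -> nat,
  b = \sum_i (- a i) *+ c i \/ b = - \sum_i (- a i) *+ c i.
Proof.
have sumN (c : 'I_r -> nat) : \sum_i (- a i) *+ c i = - \sum_i a i *+ c i.
  by rewrite -sumrN; apply: eq_bigr => i _; rewrite mulNrn.
by move=> /sgn[c bE]; exists c; rewrite sumN opprK; case: bE; [right|left].
Qed.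

Lemma in_degree_opp k x : in_degree (fun i => - E i) q k x <-> deg (- k) x.
Proof.
rewrite /in_degree linearN brNl scaleNr; split => [<-|->]; first by rewrite opprK.
by rewrite opprK.
Qed.

Lemma degreeN1_generated (B : {vspace g}) :
  (forall x, x \in root_space br (- a q) -> x \in B) ->
  (forall x y, deg 0 x -> y \in B -> br x y \in B) ->
  forall x, deg (-1) x -> x \in B.
Proof.
move=> B1 B0 x xN; apply: (degree1_generated aE' aD' sgn' B1 (q := q)).
  by move=> y z /in_degree_opp; rewrite oppr0; exact: B0.
exact/in_degree_opp.
Qed.

Lemma degreeN2_eq0 : (forall x y, deg (-1) x -> deg (-1) y -> br x y = 0) ->
  forall x, deg (- 2%:R) x -> x = 0.
Proof.
move=> b0 x x2.
suff : x \in (0%VS : {vspace g}) by rewrite memv0 => /eqP.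
apply: (degreeS_generated aE' aD' sgn' (q := q) (k := 0)).
- by move=> u v /in_degree_opp uN /in_degree_opp vN; rewrite memv0 b0.
- by move=> u v _; rewrite !memv0 => /eqP->; rewrite br0r.
exact/in_degree_opp.
Qed.

(** The centralizer of g(1) is stable under g(0) and contains the brackets of g(1), hence contains
    g(2), which they generate. Then g(3), generated by brackets of g(1) with g(2), vanishes. *)
Lemma degree3_eq0 :
  (forall x y z, deg 1 x -> deg 1 y -> deg 1 z -> br x (br y z) = 0) ->
  forall x, deg 3%:R x -> x = 0.
Proof.
move=> b0.
have [||B BP] := @ex_vspace K g (fun y => forall x, deg 1 x -> br x y = 0).
- by move=> x _; rewrite br0r.
- by move=> c u v u0 v0 x x1; rewrite brDr brZr u0 // v0 // scaler0 addr0.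
have B2 : forall x, deg 2%:R x -> x \in B.
  apply: (degreeS_generated aE aD sgn (q := q) (k := 0)).
    by move=> x y x1 y1; apply/BP => z z1; exact: b0.
  move=> x y x0 /BP y0; apply/BP => z z1.
  rewrite br_br (y0 z) // br0r addr0 brC brC; rewrite (y0 (br z x)) ?oppr0 ?opprK //.
  by rewrite -[1]addr0; exact: in_degree_br.
move=> x x3; suff : x \in (0%VS : {vspace g}) by rewrite memv0 => /eqP.
apply: (degreeS_generated aE aD sgn (q := q) (k := 1)) x3.
  by move=> u v u1 /B2/BP v2; rewrite v2 ?mem0v.
by move=> u v _; rewrite !memv0 => /eqP->; rewrite br0r.
Qed.

(** If [W] meets the root space of [- a q], that root space generates g(-1) inside [W]. If not, [W]
    is orthogonal to the root space of [a q]; its orthogonal is stable under g(0), so it contains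
    g(1), and [W] is 0 by nondegeneracy. *)
Lemma degreeN1_irreducible (W : {vspace g}) :
  (forall x, x \in W -> deg (-1) x) ->
  (forall x y, deg 0 x -> y \in W -> br x y \in W) ->
  W != 0%VS -> forall x, deg (-1) x -> x \in W.
Proof.
move=> WN W0 Wn0.
have hW H x : x \in W -> br (vsval H) x \in W.
  by apply: W0; rewrite /in_degree cartan_abelian scale0r.
have [[x [xW xq x0]]|nex] := pselect (exists x, [/\ x \in W, x \in root_space br (- a q) & x != 0]).
  apply: degreeN1_generated => // y yq.
  have aq0 : - a q != 0 by rewrite oppr_eq0 root_neq0.
  by have [c ->] := root_space_line aq0 xq x0 yq; rewrite memvZ.
exfalso; case/negP: Wn0; rewrite -subv0.
have [||W' W'P] := @ex_vspace K g (fun z => forall w, w \in W -> killing br z w = 0).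
- by move=> w _; rewrite killing0l.
- by move=> c u v u0 v0 w wW; rewrite killingDl killingZl u0 // v0 // mulr0 addr0.
have W'1 : forall x, deg 1 x -> x \in W'.
  apply: (degree1_generated aE aD sgn (q := q)).
    move=> z zq; apply/W'P.
    apply: weight_ind_pred => [|c u v|||H u|b w wW wb].
    - exact: mem0v.
    - by move=> uW vW; rewrite memvD ?memvZ.
    - by rewrite linear0.
    - by move=> c u v zu zv; rewrite linearD /= killingZr zu zv mulr0 addr0.
    - exact: hW.
    have [b0|b0] := eqVneq (a q + b) 0; last exact: killing_root_space b0 zq wb.
    have eb : b = - a q by apply/eqP; rewrite -addr_eq0 addrC b0.
    have [->|w0] := eqVneq w 0; first by rewrite linear0.
    by case: nex; exists w; rewrite -eb.
  move=> x y x0 /W'P y0; apply/W'P => w wW; rewrite killing_brN y0 ?oppr0 //.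
  exact: W0.
apply: (weight_ind hW) => b w wW wb; rewrite memv0; apply: contraT => w0.
have [z zb kwz] := killing_root_nondegenerate wb w0.
have bq : b (E q) = -1 :> K.
  exact: in_degree_uniq (in_degree_root E q wb) (WN _ wW) w0.
have /W'1/W'P/(_ _ wW) : deg 1 z.
  by have := in_degree_root E q zb; rewrite dualNE bq opprK.
by rewrite killingC kwz => /eqP; rewrite oner_eq0.
Qed.

(** The highest weight is [- a q]: adding a positive root that does not involve [a q] produces
    coefficients of both signs. *)
Lemma ex_highest_degreeN1 : exists2 x, x \in root_space br (- a q) & x != 0 /\
  forall b y, b \in Delta -> b (E q) = 0 :> K -> (forall i, 0 <= (b (E i) : K)) ->
    y \in root_space br b -> br y x = 0.
Proof.
have [x xq x0] := root_vector (aD' q); exists x => //; split => // b y bD bq b_ge0 yb.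
apply/eqP; apply: contraT => yx0.
have cq : (b - a q) (E q) = -1 :> K by rewrite dualBE bq aE eqxx sub0r.
have c0 : b - a q != 0.
  by apply/eqP => c0; move: cq; rewrite c0 dual0E => /eqP; rewrite eq_sym oppr_eq0 oner_eq0.
have [c bE c_gt0] := positive_root_sum aE sgn bD b_ge0.
case: (root_signs aE sgn (mem_roots (br_root_space yb xq) yx0 c0)) => [/(_ q)|c_le0].
  by rewrite cq oppr_ge0 ler10.
suff : (\sum_i c i)%N = 0%N by move=> c_eq0; rewrite c_eq0 in c_gt0.
apply/eqP; rewrite sum_nat_eq0; apply/forallP => i; apply/implyP => _.
have bi : b (E i) = (c i)%:R :> K by rewrite bE (sum_simple_roots aE).
have [iq|iq] := eqVneq i q.
  by move: bi; rewrite iq bq => /esym/eqP; rewrite pnatr_eq0.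
by have := c_le0 i; rewrite dualBE bi aE eq_sym (negPf iq) subr0 lern0.
Qed.

(** The lowest weight has no formula like that of the highest one, so a root of degree -1 of least
    height is chosen. *)
Lemma ex_lowest_degreeN1 : exists b x, [/\ x \in root_space br b, x != 0,
  b (E q) = -1 :> K &
  forall c y, c \in Delta -> c (E q) = 0 :> K -> (forall i, (c (E i) : K) <= 0) ->
    y \in root_space br c -> br y x = 0].
Proof.
have neg_rho c : c \in Delta -> (forall i, (c (E i) : K) <= 0) ->
    exists2 n, (0 < n)%N & c rho = - n%:R :> K.
  move=> cD c_le0.
  have [|d dE d_gt0] := positive_root_sum aE sgn (opp_root cD).
    by move=> i; rewrite dualNE oppr_ge0.
  by exists (\sum_i d i)%N => //; rewrite -(opprK c) dE dualNE (sum_rho aE).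
(* [N c] is minus the height when [c] is a root of degree -1; [NP] leaves other values unspecified.
   The sum of [N] over [Delta] bounds the maximum taken below. *)
have /choice[N NP] (c : dual h) : exists n : nat,
    c \in Delta -> c (E q) = -1 :> K -> c rho = - n%:R :> K.
  have [cD|] := boolP (c \in Delta); last by exists 0%N.
  have [cq|] := pselect (c (E q) = -1 :> K); last by exists 0%N.
  have [|n _ cn] := neg_rho c cD; last by exists n.
  case: (root_signs aE sgn cD) => // /(_ q); rewrite cq oppr_ge0 ler10 //.
pose P n := `[< exists2 c : dual h, c \in Delta & c (E q) = -1 :> K /\ c rho = - n%:R :> K >].
have exP : exists n, P n.
  exists (N (- a q)); apply/asboolP; exists (- a q); first exact: aD'.
  have aq1 : (- a q) (E q) = -1 :> K by rewrite dualNE aE eqxx.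
  by split => //; apply: NP => //; exact: aD'.
have bP n : P n -> (n <= \sum_(c <- Delta) N c)%N.
  move=> /asboolP[c cD [cq crho]]; have := NP c cD cq; rewrite crho => /oppr_inj/eqP.
  by rewrite eqr_nat => /eqP ->; rewrite (big_rem c) //= leq_addr.
case: (ex_maxnP exP bP) => n /asboolP[b bD [bq brho]] maxn.
have [x xb x0] := root_vector bD; exists b, x; split => // c y cD cq c_le0 yc.
apply/eqP; apply: contraT => yx0.
have [m m_gt0 crho] := neg_rho c cD c_le0.
have cbq : (c + b) (E q) = -1 :> K by rewrite dualDE cq bq add0r.
have /maxn : P (m + n)%N.
  apply/asboolP; exists (c + b); last by split=> //; rewrite dualDE crho brho -opprD natrD.
  apply: mem_roots (br_root_space yc xb) yx0 _; apply/eqP => cb0.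
  by move: cbq; rewrite cb0 dual0E => /eqP; rewrite eq_sym oppr_eq0 oner_eq0.
by rewrite -[X in (_ <= X)%N]add0n leq_add2r leqNgt m_gt0.
Qed.

Lemma degree0_stable (M : {vspace g}) :
  (forall H x, x \in M -> br (vsval H) x \in M) ->
  (forall b y x, b \in Delta -> b (E q) = 0 :> K -> y \in root_space br b ->
    x \in M -> br y x \in M) ->
  forall y x, deg 0 y -> x \in M -> br y x \in M.
Proof.
move=> hM bM y x y0 xM; move: y y0.
apply: in_degree_ind => [|c u v uM vM|b y yb bq]; first by rewrite br0l mem0v.
  by rewrite brDl brZl memvD ?memvZ.
have [->|y0] := eqVneq y 0; first by rewrite br0l mem0v.
have [b0|b0] := eqVneq b 0; last exact: (bM b) (mem_roots yb y0 b0) bq yb xM.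
by move: yb; rewrite b0 root_space0 => yh; rewrite -(vsprojK yh) hM.
Qed.

(* The subspace that [v] generates is stable under the negative root spaces of
   degree 0 as well, because they kill [v]; so irreducibility applies. *)
Lemma lowest_generates b v (B : {vspace g}) : v \in root_space br b -> v != 0 ->
  b (E q) = -1 :> K ->
  (forall c y, c \in Delta -> c (E q) = 0 :> K -> (forall i, (c (E i) : K) <= 0) ->
    y \in root_space br c -> br y v = 0) ->
  v \in B -> (forall H x, x \in B -> br (vsval H) x \in B) ->
  (forall c y x, c \in Delta -> c (E q) = 0 :> K -> (forall i, 0 <= (c (E i) : K)) ->
    y \in root_space br c -> x \in B -> br y x \in B) ->
  forall x, deg (-1) x -> x \in B.
Proof.
move=> vb v0 bq low vB hB pB.
pose S (f : g -> g) := (exists H, f = br (vsval H)) \/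
  (exists c z, [/\ c \in Delta, c (E q) = 0 :> K, forall i, 0 <= (c (E i) : K),
     z \in root_space br c & f = br z]).
have [M [vM SM minM]] := ex_smallest_stable S v.
have hM H x : x \in M -> br (vsval H) x \in M by move=> xM; apply: SM => //; left; exists H.
have pM c y x : c \in Delta -> c (E q) = 0 :> K -> (forall i, 0 <= (c (E i) : K)) ->
    y \in root_space br c -> x \in M -> br y x \in M.
  by move=> cD cq c_ge0 yc xM; apply: SM => //; right; exists c, y.
have nM c y x : c \in Delta -> c (E q) = 0 :> K -> (forall i, (c (E i) : K) <= 0) ->
    y \in root_space br c -> x \in M -> br y x \in M.
  have [||A AP] := @ex_vspace K g (fun x => x \in M /\
      forall c y, c \in Delta -> c (E q) = 0 :> K -> (forall i, (c (E i) : K) <= 0) ->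
      y \in root_space br c -> br y x \in M).
  - by split=> [|*]; rewrite ?br0r mem0v.
  - move=> k u w [uM uE] [wM wE]; split; first by rewrite memvD ?memvZ.
    by move=> d z *; rewrite brDr brZr memvD ?memvZ ?(uE d) ?(wE d).
  have MA : (M <= A)%VS.
    apply: minM; first by apply/AP; split=> // d z *; rewrite (low d) ?mem0v.
    move=> f u Sf /AP[uM uE]; apply/AP; split; first exact: SM.
    move=> d z dD dq d_le0 zd; case: Sf => [[H ->]|[e [w [eD eq e_ge0 we ->]]]];
      rewrite br_br memvD //.
    - by apply: (uE d) => //; rewrite -[d]addr0; apply: br_root_space => //; exact: subvs_root_space0.
    - exact/hM/(uE d).
    - have zw := br_root_space zd we.
      have [->|zw0] := eqVneq (br z w) 0; first by rewrite br0l mem0v.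
      have [de0|de0] := eqVneq (d + e) 0.
        by move: zw; rewrite de0 root_space0 => zwh; rewrite -(vsprojK zwh) hM.
      have deD := mem_roots zw zw0 de0.
      have deq : (d + e) (E q) = 0 :> K by rewrite dualDE dq eq addr0.
      case: (root_signs aE sgn deD) => de_s; first exact: (pM _ _ _ deD).
      exact: (uE _ _ deD).
    - by apply: (pM e) => //; exact: (uE d).
  by move=> cD cq c_le0 yc /(subvP MA)/AP[_ /(_ c y cD cq c_le0 yc)].
have [D DP] := ex_vspace (in_degree0 E q (-1)) (in_degreeP (k := -1)).
have MD : (M <= D)%VS.
  apply: minM; first by apply/DP; rewrite -bq; exact: in_degree_root.
  move=> f u Sf /DP u1; apply/DP.
  case: Sf => [[H ->]|[c [z [_ cq _ zc ->]]]]; first exact: in_degree_cartan.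
  by rewrite -[-1]add0r; apply: in_degree_br => //; rewrite -cq; exact: in_degree_root.
have MB : (M <= B)%VS.
  apply: minM => // f u [[H ->]|[c [z [cD cq c_ge0 zc ->]]]] uB; first exact: hB.
  exact: pB cD cq c_ge0 zc uB.
move=> x x1; apply: (subvP MB); apply: degreeN1_irreducible x1.
- by move=> y /(subvP MD)/DP.
- apply: degree0_stable => // c y u cD cq yc uM.
  by case: (root_signs aE sgn cD) => c_s; [apply: (pM c) | apply: (nM c)].
- by apply: contraNneq v0 => M0; rewrite -memv0 -M0.
Qed.

(** Bilinearity is asked on all of [g], but equivariance only for arguments of degree -1, where the
    map built from an isomorphism onto g(-1) has it. *)
Definition degree0_bilinear (Psi : g -> g -> g) : Prop :=
  [/\ forall w, linear (Psi^~ w), forall u, linear (Psi u) &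
    forall x u w, deg 0 x -> deg (-1) u -> deg (-1) w ->
      br x (Psi u w) = Psi (br x u) w + Psi u (br x w)].

(* [Psi] is determined by its value at (highest vector, lowest vector), which
   lies in a root space, hence in a line. *)
Lemma degree0_bilinear_unique Psi : degree0_bilinear Psi ->
  (exists u w, [/\ deg (-1) u, deg (-1) w & br u w != 0]) ->
  exists c, forall u w, deg (-1) u -> deg (-1) w -> Psi u w = c *: br u w.
Proof.
move=> PsiP [u0 [w0 [u01 w01 uw0]]].
have [e eq [e0 high]] := ex_highest_degreeN1.
have [b [v [vb v0 bq low]]] := ex_lowest_degreeN1.
have e1 : deg (-1) e by have := in_degree_root E q eq; rewrite dualNE aE eqxx.
have v1 : deg (-1) v by have := in_degree_root E q vb; rewrite bq.
have hdeg H : deg 0 (vsval H) by rewrite /in_degree cartan_abelian scale0r.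
have deg0b (c : dual h) y : c (E q) = 0 :> K -> y \in root_space br c -> deg 0 y.
  by move=> cq yc; have := in_degree_root E q yc; rewrite cq.
have deg01 x u : deg 0 x -> deg (-1) u -> deg (-1) (br x u).
  by move=> x0 u1; rewrite -[-1]add0r; exact: in_degree_br.
(* Two propagations. Since [e] is highest, the [u] with [Th e u = 0] are stable under [h] and the
   positive root spaces of degree 0; they include the lowest vector, so they fill g(-1). Then the
   [u] with [Th u] zero on g(-1) form a g(0)-submodule containing [e], and irreducibility
   applies. *)
have vanish Th : degree0_bilinear Th -> Th e v = 0 ->
    forall u w, deg (-1) u -> deg (-1) w -> Th u w = 0.
  move=> [ThL ThR ThE] ev0.
  have Th0r u : Th u 0 = 0.
    have := ThR u (-1) 0 0; rewrite !scaler0 !addr0 => ->.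
    by rewrite scaleN1r addNr.
  have Th0l w : Th 0 w = 0.
    have := ThL w (-1) 0 0; rewrite !scaler0 !addr0 => ->.
    by rewrite scaleN1r addNr.
  have ThZl c u w : Th (c *: u) w = c *: Th u w.
    by have := ThL w c u 0; rewrite !addr0 Th0l addr0.
  have eu0 u : deg (-1) u -> Th e u = 0.
    have [||B BP] := @ex_vspace K g (fun u => deg (-1) u /\ Th e u = 0).
    - by split=> //; exact: in_degree0.
    - move=> c x y [x1 ex] [y1 ey]; split; first exact: in_degreeP.
      by rewrite (ThR e c x y) ex ey scaler0 addr0.
    move=> u1; suff /BP[] : u \in B by [].
    apply: (lowest_generates vb v0 bq low) u1; first by apply/BP.
      move=> H x /BP[x1 ex]; apply/BP; split; first exact: deg01.
      have := ThE _ _ _ (hdeg H) e1 x1; rewrite ex br0r.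
      by move/root_spaceP: (eq) => ->; rewrite ThZl ex scaler0 add0r => <-.
    move=> c y x cD cq c_ge0 yc /BP[x1 ex]; apply/BP.
    have y0 := deg0b _ _ cq yc; split; first exact: deg01.
    have := ThE _ _ _ y0 e1 x1; rewrite ex br0r (high c) // Th0l add0r => <- //.
  have [||C CP] := @ex_vspace K g (fun u => deg (-1) u /\ forall w, deg (-1) w -> Th u w = 0).
  - by split=> [|w _]; [exact: in_degree0 | exact: Th0l].
  - move=> c x y [x1 ex] [y1 ey]; split; first exact: in_degreeP.
    by move=> w w1; rewrite (ThL w c x y) ex // ey // scaler0 addr0.
  move=> u w u1; suff /CP[_] : u \in C by apply.
  apply: degreeN1_irreducible u1.
  - by move=> x /CP[].
  - move=> x y x0 /CP[y1 ey]; apply/CP; split; first exact: deg01.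
    move=> z z1; have := ThE _ _ _ x0 y1 z1; rewrite !ey //; last exact: deg01.
    by rewrite br0r addr0 => <-.
  - by apply: contraNneq e0 => C0; rewrite -memv0 -C0; apply/CP.
have brP : degree0_bilinear (fun u w => br u w).
  split; [exact: bracket_linearl | exact: bracket_linearr |].
  by move=> x u w _ _ _; exact: br_br.
have ev0 : br e v != 0.
  by apply: contraNneq uw0 => /(vanish _ brP) ->.
have wt Th : degree0_bilinear Th -> Th e v \in root_space br (- a q + b).
  move=> [ThL ThR ThE]; apply/root_spaceP => H; rewrite (ThE _ _ _ (hdeg H)) //.
  move/root_spaceP: (eq) => ->; move/root_spaceP: (vb) => ->.
  have Th0r : Th e 0 = 0.
    have := ThR e (-1) 0 0; rewrite !scaler0 !addr0 => ->.
    by rewrite scaleN1r addNr.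
  have Th0l : Th 0 v = 0.
    have := ThL v (-1) 0 0; rewrite !scaler0 !addr0 => ->.
    by rewrite scaleN1r addNr.
  have := ThL v ((- a q) H : K) e 0; rewrite !addr0 Th0l addr0 => ->.
  have := ThR e (b H : K) v 0; rewrite !addr0 Th0r addr0 => ->.
  by rewrite -scalerDl dualDE.
have n0 : - a q + b != 0.
  apply/eqP => ab0; have : (- a q + b) (E q) = - 2%:R :> K.
    by rewrite dualDE dualNE aE eqxx bq -opprD.
  by rewrite ab0 dual0E => /eqP; rewrite eq_sym oppr_eq0 pnatr_eq0.
have [c cE] := root_space_line n0 (wt _ brP) ev0 (wt _ PsiP).
exists c => u w u1 w1; apply/eqP; rewrite -subr_eq0; apply/eqP.
apply: (vanish (fun u w => Psi u w - c *: br u w)) => //; last by rewrite cE subrr.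
have [PsiL PsiR PsiE] := PsiP; split.
- move=> y k x z; rewrite (PsiL y k x z) brDl brZl !scalerDr opprD scalerN !scalerA (mulrC c).
  by rewrite addrACA.
- move=> x k y z; rewrite (PsiR x k y z) brDr brZr !scalerDr opprD scalerN !scalerA (mulrC c).
  by rewrite addrACA.
move=> x y z x0 y1 z1; rewrite linearB linearZ /= PsiE // br_br scalerDr opprD.
by rewrite addrACA.
Qed.

(** The tensor of the dual bases is invariant under g(0), so the sum commutes with g(0). It
    therefore lies in [h] and is killed by the simple roots other than [a q]. Pairing it with [E q]
    gives 2 for each k, the degree of [X k]. *)
Lemma dual_bases_br_sum m (X Xs : 'I_m -> g) :
  (forall k, deg 2%:R (X k)) -> (forall k, deg (- 2%:R) (Xs k)) ->
  (forall i j, killing br (Xs i) (X j) = (i == j)%:R) ->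
  (forall u, deg 2%:R u -> u = \sum_k killing br u (Xs k) *: X k) ->
  (forall u, deg (- 2%:R) u -> u = \sum_k killing br u (X k) *: Xs k) ->
  (0 < m)%N ->
  exists2 c, c != 0 & \sum_k br (X k) (Xs k) = c *: vsval (E q).
Proof.
move=> X2 Xs2 kX XE XsE m_gt0; set Z := \sum_k _.
have comm x : deg 0 x -> br x Z = 0.
  move=> x0; rewrite linear_sum /=.
  transitivity (\sum_k (br (br x (X k)) (Xs k) + br (X k) (br x (Xs k)))).
    by apply: eq_bigr => k _; exact: br_br.
  rewrite big_split /=.
  have x2 k : deg 2%:R (br x (X k)) by rewrite -[2%:R]add0r; exact: in_degree_br.
  have xs2 k : deg (- 2%:R) (br x (Xs k)) by rewrite -[- _]add0r; exact: in_degree_br.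
  transitivity (\sum_k \sum_j killing br (br x (X k)) (Xs j) *: br (X j) (Xs k) +
      \sum_k \sum_j killing br (br x (Xs k)) (X j) *: br (X k) (Xs j)).
    congr (_ + _); apply: eq_bigr => k _.
      by rewrite {1}(XE _ (x2 k)) br_suml; apply: eq_bigr => j _; rewrite brZl.
    by rewrite {1}(XsE _ (xs2 k)) linear_sum; apply: eq_bigr => j _; rewrite /= brZr.
  (* After the exchange the two coefficients of [br (X j) (Xs k)] are opposite by invariance. *)
  rewrite [X in _ + X]exchange_big /= -big_split big1 // => k _ /=.
  rewrite -big_split big1 // => j _ /=.
  by rewrite killing_brN (killingC br (X k)) scaleNr addNr.
have Z0 : Z \in root_space br (0 : dual h).
  apply/root_spaceP => H; rewrite dual0E scale0r comm //.
  by rewrite /in_degree cartan_abelian scale0r.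
have aZ i : i != q -> a i (in_cartan Z) = 0 :> K.
  move=> iq; have [x xi x0] := root_vector (aD i).
  have := cartan_act Z0 xi; rewrite brC comm; last first.
    by have := in_degree_root E q xi; rewrite aE (negPf iq).
  by move/esym/eqP; rewrite oppr0 scaler_eq0 (negPf x0) orbF => /eqP.
have ZE : Z = (a q (in_cartan Z) : K) *: vsval (E q).
  rewrite {1}(cartan_expand aE sgn Z0) (bigD1 q) //= big1 ?addr0 // => i iq.
  by rewrite aZ // scale0r.
exists (a q (in_cartan Z) : K) => //; apply/eqP => c0; rewrite c0 scale0r in ZE.
have : killing br Z (vsval (E q)) = m%:R * 2%:R.
  rewrite killing_suml (eq_bigr (fun=> 2%:R)) => [|k _].
    by rewrite sumr_const card_ord mulr_natl.
  rewrite killingC -killing_br (X2 k) killingZl killingC kX eqxx mulr1 //.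
by rewrite ZE killing0l -natrM => /esym/eqP; rewrite pnatr_eq0 muln_eq0 orbF -leqn0 leqNgt m_gt0.
Qed.

End Levi.
End RootSpaces.

(** * Exponential series *)

Section CauchyProduct.

Lemma triangle_sum (V : nmodType) (u : nat -> nat -> V) n :
  \sum_(k < n) \sum_(i < k.+1) u i (k - i)%N = \sum_(i < n) \sum_(j < n - i) u i j.
Proof.
elim: n => [|n IH]; first by rewrite !big_ord0.
rewrite big_ord_recr /= IH [RHS]big_ord_recr /= subSnn big_ord1.
rewrite [X in _ + X]big_ord_recr /= subnn addrA -big_split /=; congr (_ + _).
by apply: eq_bigr => i _; rewrite subSn 1?ltnW // big_ord_recr.
Qed.

(** The error between the product of two partial sums and the partial sum of the Cauchy product; it
    serves both for brackets and for scalars. *)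
Lemma square_sub_triangle (V : zmodType) (u : nat -> nat -> V) n :
  \sum_(i < n) \sum_(j < n) u i j - \sum_(k < n) \sum_(i < k.+1) u i (k - i)%N =
  \sum_(i < n) \sum_(n - i <= j < n) u i j.
Proof.
rewrite triangle_sum -sumrB; apply: eq_bigr => i _.
rewrite -!(big_mkord xpredT (u i)) (@big_cat_nat _ _ _ (n - i)) //= ?leq_subr //.
by rewrite addrAC subrr add0r.
Qed.

(* Both the Leibniz rule and the binomial formula, for sequences normalised by
   factorials. *)
Lemma cauchy_product_step (V : zmodType) (w w' : nat -> nat -> V) k :
  (forall i j, w' i j = w i.+1 j *+ i.+1 + w i j.+1 *+ j.+1) ->
  \sum_(i < k.+1) w' i (k - i)%N = (\sum_(i < k.+2) w i (k.+1 - i)%N) *+ k.+1.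
Proof.
move=> w'E.
transitivity (\sum_(i < k.+2) w i (k.+1 - i)%N *+ i +
              \sum_(i < k.+2) w i (k.+1 - i)%N *+ (k.+1 - i)).
  rewrite [X in X + _]big_ord_recl [X in _ + X]big_ord_recr /= mulr0n add0r subnn.
  rewrite mulr0n addr0 -big_split /=; apply: eq_bigr => i _.
  by rewrite w'E subSS subSn // -ltnS.
rewrite -big_split -sumrMnl /=; apply: eq_bigr => i _.
by rewrite -mulrnDr subnKC // -ltnS.
Qed.

End CauchyProduct.

(** * Coordinate norms and bounds for linear maps *)

Section CoordNorm.
Context {K : numFieldType} {V : vectType K}.
Local Notation b := (vbasis {:V}).

(** The l1 norm in coordinates, with values in [K]; it suits the coordinatewise convergence in
    [is_exp]. *)
Definition coord_norm (v : V) : K := \sum_i `|coord b i v|.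

Lemma coord_norm_ge0 v : 0 <= coord_norm v.
Proof. exact: sumr_ge0. Qed.

Lemma ler_coord_norm i v : `|coord b i v| <= coord_norm v.
Proof. by rewrite /coord_norm (bigD1 i) //= lerDl sumr_ge0. Qed.

Lemma coord_normZ c v : coord_norm (c *: v) = `|c| * coord_norm v.
Proof. by rewrite mulr_sumr; apply: eq_bigr => i _; rewrite linearZ normrM. Qed.

Lemma ler_coord_norm_sum (I : Type) (s : seq I) (P : pred I) (F : I -> V) :
  coord_norm (\sum_(i <- s | P i) F i) <= \sum_(i <- s | P i) coord_norm (F i).
Proof.
rewrite /coord_norm exchange_big /=; apply: ler_sum => i _.
by rewrite linear_sum; exact: ler_norm_sum.
Qed.

Lemma vbasis_expand v : v = \sum_i coord b i v *: b`_i.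
Proof. exact: coord_basis (vbasisP fullv) (memvf v). Qed.

End CoordNorm.

Lemma bilinear_expand (K : numFieldType) (V : vectType K) (W : lmodType K)
    (beta : V -> V -> W) (b := vbasis {:V}) :
  (forall v, linear (beta^~ v)) -> (forall u, linear (beta u)) ->
  forall u v, beta u v = \sum_i \sum_j (coord b i u * coord b j v) *: beta b`_i b`_j.
Proof.
move=> betal betar u v.
have sumP (f : V -> W) : linear f -> forall w, f w = \sum_i coord b i w *: f b`_i.
  move=> f_lin w; pose fM := GRing.isLinear.Build _ _ _ _ f f_lin.
  pose fL : {linear V -> W} := HB.pack f fM.
  rewrite -[f w]/(fL w) {1}(vbasis_expand w) linear_sum.
  by apply: eq_bigr => i _; rewrite linearZ.
rewrite (sumP _ (betal v)); apply: eq_bigr => i _; rewrite (sumP _ (betar _)).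
by rewrite scaler_sumr; apply: eq_bigr => j _; rewrite scalerA.
Qed.

Lemma lfun_bounded (K : numFieldType) (U V : vectType K) (f : 'Hom(U, V)) :
  exists2 A, 0 <= A & forall v, coord_norm (f v) <= A * coord_norm v.
Proof.
exists (\sum_(i < \dim {:U}) coord_norm (f (vbasis {:U})`_i)).
  by apply: sumr_ge0 => i _; exact: coord_norm_ge0.
move=> v; rewrite {1}(vbasis_expand v) linear_sum.
apply: le_trans (ler_coord_norm_sum _ _ _) _; rewrite mulr_suml; apply: ler_sum => i _.
rewrite linearZ coord_normZ mulrC ler_wpM2l ?coord_norm_ge0 //; exact: ler_coord_norm.
Qed.

Lemma iter_lfun_bounded (K : numFieldType) (V : vectType K) (f : 'End(V)) A :
  0 <= A -> (forall v, coord_norm (f v) <= A * coord_norm v) ->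
  forall k v, coord_norm (iter k f v) <= A ^+ k * coord_norm v.
Proof.
move=> A0 fA; elim=> [|k IH] v; first by rewrite mul1r.
apply: le_trans (fA _) _; rewrite exprS -mulrA ler_wpM2l //; exact: IH.
Qed.

Lemma cvg_dist_le (K : numFieldType) (u : nat -> K) (l c B : K) m :
  u @ \oo --> l -> 0 <= B -> (forall n, `|u (m + n)%N - c| <= B) -> `|l - c| <= B.
Proof.
move=> /cvgrPdist_lt ul B0 uB.
rewrite real_leNgt ?normr_real ?ger0_real //; apply/negP => lt_B.
have /ul[n0 _ /(_ (m + n0)%N (leq_addl _ _)) /= lt_n0] : 0 < `|l - c| - B by rewrite subr_gt0.
have := le_lt_trans (ler_distD (u (m + n0)%N) l c) (ltr_leD lt_n0 (uB n0)).
by rewrite subrK ltxx.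
Qed.

(** * First-order expansions at 0 *)

Section FirstOrder.
Context {K : numFieldType}.
Implicit Types (F G : K -> K) (a b : K).

(** That is, [F t = a + b t + O(t^2)] near 0, as an explicit estimate. A radius at most 1 lets
    higher powers of [t] be absorbed into the square. *)
Definition first_order F a b : Prop := exists d M, [/\ 0 < d <= 1, 0 <= M &
  forall t, `|t| <= d -> `|F t - (a + b * t)| <= M * `|t| ^+ 2].

Lemma first_order_const a : first_order (fun=> a) a 0.
Proof.
exists 1, 0; rewrite ltr01 lexx; split => // t _.
by rewrite mul0r addr0 subrr normr0 mul0r.
Qed.

Lemma first_order_scale c F a b :
  first_order F a b -> first_order (fun t => c * F t) (c * a) (c * b).
Proof.
move=> [d [M [d01 M0 FM]]]; exists d, (`|c| * M); split; rewrite ?mulr_ge0 // => t td.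
by rewrite -mulrA -mulrDr -mulrBr normrM -mulrA ler_wpM2l // FM.
Qed.

Lemma first_order_common F G a b a' b' : first_order F a b -> first_order G a' b' ->
  exists d M, [/\ 0 < d <= 1, 0 <= M & forall t, `|t| <= d ->
    `|F t - (a + b * t)| <= M * `|t| ^+ 2 /\ `|G t - (a' + b' * t)| <= M * `|t| ^+ 2].
Proof.
move=> [d [M [/andP[d0 d1] M0 FM]]] [d' [M' [/andP[d'0 d'1] M'0 GM]]].
(* Both radii are at most 1, so their product is below each of them. *)
exists (d * d'), (M + M'); split; first by rewrite mulr_gt0 //= mulr_ile1 // ltW.
  exact: addr_ge0.
move=> t td; have t2 : 0 <= `|t| ^+ 2 by rewrite exprn_ge0.
split; rewrite mulrDl.
  apply: le_trans (FM t _) _; last by rewrite lerDl mulr_ge0.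
  by apply: le_trans td _; rewrite ler_piMr // ltW.
apply: le_trans (GM t _) _; last by rewrite lerDr mulr_ge0.
by apply: le_trans td _; rewrite ler_piMl // ltW.
Qed.

Lemma first_order_add F G a b a' b' : first_order F a b -> first_order G a' b' ->
  first_order (fun t => F t + G t) (a + a') (b + b').
Proof.
move=> Fab Gab; have [d [M [d01 M0 FG]]] := first_order_common Fab Gab.
exists d, (M + M); split; rewrite ?addr_ge0 // => t /FG[Ft Gt].
have -> : F t + G t - (a + a' + (b + b') * t) = (F t - (a + b * t)) + (G t - (a' + b' * t)).
  by ring.
by rewrite mulrDl; apply: le_trans (ler_normD _ _) _; exact: lerD.
Qed.

Lemma first_order_sum (I : Type) (s : seq I) (F : I -> K -> K) (a b : I -> K) :
  (forall i, first_order (F i) (a i) (b i)) ->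
  first_order (fun t => \sum_(i <- s) F i t) (\sum_(i <- s) a i) (\sum_(i <- s) b i).
Proof.
move=> FP; elim: s => [|i s IH].
  rewrite !big_nil (_ : (fun t => _) = fun=> 0); first exact: first_order_const.
  by apply/funext => t; rewrite big_nil.
rewrite !big_cons (_ : (fun t => _) = fun t => F i t + \sum_(j <- s) F j t).
  exact: first_order_add.
by apply/funext => t; rewrite big_cons.
Qed.

Lemma first_order_mul F G a b a' b' : first_order F a b -> first_order G a' b' ->
  first_order (fun t => F t * G t) (a * a') (a * b' + b * a').
Proof.
move=> Fab Gab; have [d [M [/andP[d0 d1] M0 FG]]] := first_order_common Fab Gab.
(* With error terms [f] and [g], the three summands bound [b b' t^2], [(a + b t) g] and
   [f (a' + b' t + g)]. *)
pose N := `|b * b'| + (`|a| + `|b|) * M + M * (`|a'| + `|b'| + M).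
exists d, N; split; first by rewrite d0.
  by rewrite /N !addr_ge0 ?mulr_ge0 ?addr_ge0.
move=> t td; have [Ft Gt] := FG t td.
have t1 : `|t| <= 1 by exact: le_trans td d1.
have t21 : `|t| ^+ 2 <= 1 by rewrite exprn_ile1.
have lin_le u v : `|u + v * t| <= `|u| + `|v|.
  by apply: le_trans (ler_normD _ _) _; rewrite lerD2l normrM ler_piMr.
set f := F t - (a + b * t) in Ft; set g := G t - (a' + b' * t) in Gt.
have FE : F t = a + b * t + f by rewrite /f addrC subrK.
have GE : G t = a' + b' * t + g by rewrite /g addrC subrK.
have -> : F t * G t - (a * a' + (a * b' + b * a') * t) =
    b * b' * t ^+ 2 + (a + b * t) * g + f * (a' + b' * t + g).
  by rewrite FE GE; ring.
have -> : N * `|t| ^+ 2 = `|b * b'| * `|t| ^+ 2 + (`|a| + `|b|) * M * `|t| ^+ 2 +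
    M * (`|a'| + `|b'| + M) * `|t| ^+ 2 by rewrite /N; ring.
apply: le_trans (ler_normD _ _) _; apply: lerD; last first.
  rewrite normrM mulrAC; apply: ler_pM => //.
  apply: le_trans (ler_normD _ _) _; apply: lerD; first exact: lin_le.
  by apply: le_trans Gt _; rewrite ler_piMr.
apply: le_trans (ler_normD _ _) _; apply: lerD.
  by rewrite normrM normrX.
by rewrite normrM -mulrA; apply: ler_pM => //; exact: lin_le.
Qed.

Lemma first_order_uniq F a b a' b' : first_order F a b -> first_order F a' b' ->
  b = b'.
Proof.
move=> Fab Fab'; have [d [M [/andP[d0 d1] M0 FG]]] := first_order_common Fab Fab'.
have at0 c e : `|F 0 - (c + e * 0)| <= M * `|0| ^+ 2 -> c = F 0.
  by rewrite mulr0 addr0 normr0 expr0n mulr0 normr_le0 subr_eq0 => /eqP.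
have := FG 0; rewrite {1}normr0 => /(_ (ltW d0)) [/at0 aE /at0 a'E].
rewrite aE a'E in FG.
apply/eqP; rewrite -subr_eq0 -normr_le0 real_leNgt ?normr_real ?real0 //.
apply/negP => bb0.
(* Chosen so that [t <= d] and [(M + M) t < |b - b'|], whereas the two expansions give the opposite
   inequality. *)
pose t := d * (`|b - b'| / (`|b - b'| + (M + M))).
have den0 : 0 < `|b - b'| + (M + M) by rewrite ltr_wpDr ?addr_ge0.
have t0 : 0 < t by rewrite mulr_gt0 ?divr_gt0.
have td : `|t| <= d.
  rewrite (gtr0_norm t0); apply: ler_piMr; first exact: ltW.
  rewrite ler_pdivrMr // mul1r lerDl.
  exact: addr_ge0.
have [Ft Ft'] := FG t td; rewrite (gtr0_norm t0) in Ft Ft'.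
have : `|b - b'| * t <= (M + M) * t ^+ 2.
  rewrite -{1}(gtr0_norm t0) -normrM.
  have -> : (b - b') * t = (F t - (F 0 + b' * t)) - (F t - (F 0 + b * t)) by ring.
  by rewrite [_ * t ^+ 2]mulrDl; apply: le_trans (ler_normB _ _) _; exact: lerD.
rewrite expr2 (mulrA (M + M) t t) (ler_pM2r t0) => le_t.
have : `|b - b'| * (`|b - b'| + (M + M)) <= (M + M) * `|b - b'|.
  apply: le_trans (_ : (M + M) * t * (`|b - b'| + (M + M)) <= _).
    by rewrite ler_pM2r.
  rewrite /t -!mulrA mulVf ?gt_eqF // mulr1; apply: ler_wpM2l; first exact: addr_ge0.
  by rewrite ler_piMl // ltW.
rewrite mulrDr [X in _ + X]mulrC gerDr => le0.
by have := lt_le_trans (mulr_gt0 bb0 bb0) le0; rewrite ltxx.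
Qed.

End FirstOrder.

Lemma iter_scale (K : fieldType) (V : vectType K) (f : 'End(V)) t k v :
  iter k (t *: f) v = t ^+ k *: iter k f v.
Proof.
elim: k => [|k IH] /=; first by rewrite scale1r.
by rewrite IH scale_lfunE linearZ scalerA exprS.
Qed.

Lemma geometric_le2 (K : numFieldType) (x : K) n :
  0 <= x -> x <= 2%:R^-1 -> \sum_(k < n) x ^+ k <= 2%:R.
Proof.
move=> x0 x2; suff : \sum_(k < n) x ^+ k + 2%:R * x ^+ n <= 2%:R.
  by apply: le_trans; rewrite lerDl mulr_ge0 ?exprn_ge0 ?ler0n.
elim: n => [|n IH]; first by rewrite big_ord0 add0r mulr1.
rewrite big_ord_recr /=; apply: le_trans IH; rewrite -addrA lerD2l.
rewrite exprS mulrA (_ : 2%:R * x ^+ n = x ^+ n + x ^+ n); last by rewrite mulr_natl.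
rewrite lerD2l ler_piMl ?exprn_ge0 //.
by rewrite mulrC -ler_pdivlMr ?ltr0n // div1r.
Qed.

Lemma invfact_le1 (K : numFieldType) k : `|(k`!%:R : K)^-1| <= 1.
Proof.
by rewrite normfV normr_nat invf_le1 ?ltr0n ?fact_gt0 // ler1n fact_gt0.
Qed.

Lemma exp_first_order (K : numFieldType) (V : vectType K) (f : 'End(V))
    (e : K -> 'End(V)) : (forall t, is_exp (t *: f) (e t)) ->
  forall v i, first_order (fun t => coord (vbasis {:V}) i (e t v))
    (coord (vbasis {:V}) i v) (coord (vbasis {:V}) i (f v)).
Proof.
move=> eP v i; have [A A0 fA] := lfun_bounded f.
pose B := A + 1; have B1 : 1 <= B by rewrite lerDr.
have B0 : 0 < B by exact: lt_le_trans ltr01 B1.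
have fB u : coord_norm (f u) <= B * coord_norm u.
  by apply: le_trans (fA u) _; rewrite ler_wpM2r ?coord_norm_ge0 // lerDl.
have M0 : 0 <= B ^+ 2 * 2%:R * coord_norm v.
  by rewrite !mulr_ge0 ?coord_norm_ge0 ?exprn_ge0 ?ler0n // ltW.
(* Within this radius [|t| B <= 1/2], so the terms of order at least 2 are bounded by [(|t| B)^2]
   times a geometric sum, itself at most 2. That [B >= 1] keeps the radius below 1. *)
exists (2%:R * B)^-1, (B ^+ 2 * 2%:R * coord_norm v); split => //.
  rewrite invr_gt0 mulr_gt0 ?ltr0n //= invf_le1 ?mulr_gt0 ?ltr0n //.
  by apply: le_trans B1 _; rewrite ler_peMl ?ler1n // ltW.
move=> t td; apply: (@cvg_dist_le _ _ _ _ _ 2 (eP t v i)).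
  by rewrite mulr_ge0 // exprn_ge0.
move=> n; rewrite add2n !big_ord_recl /= !fact0 /bump /= !add1n addrA.
rewrite !linearD /= !invr1 !scale1r scale_lfunE linearZ /=.
rewrite [_ * t]mulrC -opprD addrAC subrr add0r linear_sum /=.
apply: le_trans (ler_norm_sum _ _ _) _.
have tB : `|t| * B <= 2%:R^-1.
  by rewrite -ler_pdivlMr // -invfM.
apply: (@le_trans _ _ (\sum_(k < n) `|t| ^+ 2 * B ^+ 2 * coord_norm v * (`|t| * B) ^+ k)).
  apply: ler_sum => k _; rewrite linearZ normrM /=.
  have -> : (t *: f) ((t *: f) (iter (0 + k) (t *: f) v)) = t ^+ k.+2 *: iter k.+2 f v.
    by rewrite -iter_scale.
  rewrite linearZ normrM normrX.
  apply: le_trans (_ : 1 * (`|t| ^+ k.+2 * (B ^+ k.+2 * coord_norm v)) <= _).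
    apply: ler_pM => //; [by rewrite mulr_ge0 ?exprn_ge0 | exact: invfact_le1 |].
    rewrite ler_wpM2l ?exprn_ge0 //; apply: le_trans (ler_coord_norm _ _) _.
    by apply: iter_lfun_bounded => //; exact: ltW.
  by rewrite le_eqVlt; apply/orP; left; apply/eqP; rewrite exprMn !exprS; ring.
rewrite -mulr_sumr.
apply: le_trans (_ : `|t| ^+ 2 * B ^+ 2 * coord_norm v * 2%:R <= _).
  rewrite ler_wpM2l ?geometric_le2 //; last by rewrite mulr_ge0 // ltW.
  by rewrite !mulr_ge0 ?coord_norm_ge0 ?exprn_ge0 // ltW.
by rewrite le_eqVlt; apply/orP; left; apply/eqP; ring.
Qed.

Lemma cvg_sumr (K : numFieldType) (I : Type) (s : seq I) (f : I -> nat -> K) (l : I -> K) :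
  (forall i, f i n @[n --> \oo] --> l i) ->
  (\sum_(i <- s) f i n) @[n --> \oo] --> \sum_(i <- s) l i.
Proof.
move=> fl; elim: s => [|i s IH].
  rewrite big_nil (_ : (fun n => _) = fun=> 0); first exact: cvg_cst.
  by apply/funext => n; rewrite big_nil.
rewrite big_cons (_ : (fun n => _) = fun n => f i n + \sum_(j <- s) f j n).
  by apply: cvgD.
by apply/funext => n; rewrite big_cons.
Qed.

Lemma bilinear_limit (K : numFieldType) (V : vectType K) (br : V -> V -> V)
    (u v w : nat -> V) (lu lv lw : V) (b := vbasis {:V}) :
  (forall x y, br x y = \sum_i \sum_j (coord b i x * coord b j y) *: br b`_i b`_j) ->
  (forall i, coord b i (u n) @[n --> \oo] --> coord b i lu) ->
  (forall i, coord b i (v n) @[n --> \oo] --> coord b i lv) ->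
  (forall i, coord b i (w n) @[n --> \oo] --> coord b i lw) ->
  (forall i ep, 0 < ep -> exists n0, forall n, (n0 <= n)%N ->
     `|coord b i (br (u n) (v n) - w n)| < ep) ->
  lw = br lu lv.
Proof.
move=> brE ucvg vcvg wcvg small.
rewrite (vbasis_expand lw) (vbasis_expand (br lu lv)).
apply: eq_bigr => l _; congr (_ *: _).
have Dcvg : coord b l (br (u n) (v n) - w n) @[n --> \oo] -->
    coord b l (br lu lv) - coord b l lw.
  rewrite (_ : (fun n => _) = (fun n => \sum_i \sum_j
     coord b i (u n) * coord b j (v n) * coord b l (br b`_i b`_j) - coord b l (w n))).
    apply: cvgB; last exact: wcvg.
    rewrite brE linear_sum /=; apply: cvg_sumr => i.
    rewrite linear_sum; apply: cvg_sumr => j; rewrite linearZ /=.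
    by apply: cvgM; [apply: cvgM|exact: cvg_cst].
  apply/funext => n; rewrite linearB /=; congr (_ - _).
  rewrite brE linear_sum; apply: eq_bigr => i _; rewrite linear_sum.
  by apply: eq_bigr => j _; rewrite linearZ.
apply/eqP; rewrite eq_sym -subr_eq0; apply: contraT => pq0.
set p := _ - _ in Dcvg pq0.
have p_gt0 : 0 < `|p| / 2%:R by rewrite divr_gt0 ?normr_gt0 ?ltr0n.
have [n1 _ n1P] := (cvgrPdist_lt _ _).1 Dcvg _ p_gt0.
have [n2 n2P] := small l _ p_gt0.
pose n := maxn n1 n2.
have := n1P n (leq_maxl _ _); have := n2P n (leq_maxr _ _); rewrite /= => D_lt2 D_lt.
have := le_lt_trans (ler_normD _ _) (ltrD D_lt D_lt2).
by rewrite subrK -splitr ltxx.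
Qed.

(** * The exponential of a derivation respects the bracket *)

Section ExpMorphism.
Context {R : realType} {V : vectType R[i]} (br : V -> V -> V).
Context (brl : forall y, linear (br^~ y)) (brr : forall x, linear (br x)).
Local Notation b := (vbasis {:V}).
Local Notation K := R[i].

Let brDl y u v : br (u + v) y = br u y + br v y.
Proof. by have := brl y 1 u v; rewrite !scale1r. Qed.
Let br0l y : br 0 y = 0.
Proof. by have := brl y (-1) 0 0; rewrite scaler0 addr0 scaleN1r addNr. Qed.
Let brZl y c u : br (c *: u) y = c *: br u y.
Proof. by have := brl y c u 0; rewrite br0l !addr0. Qed.
Let brDr y u v : br y (u + v) = br y u + br y v.
Proof. by have := brr y 1 u v; rewrite !scale1r. Qed.
Let br0r y : br y 0 = 0.
Proof. by have := brr y (-1) 0 0; rewrite scaler0 addr0 scaleN1r addNr. Qed.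
Let brZr y c u : br y (c *: u) = c *: br y u.
Proof. by have := brr y c u 0; rewrite br0r !addr0. Qed.
Let br_suml y I (s : seq I) F : br (\sum_(i <- s) F i) y = \sum_(i <- s) br (F i) y.
Proof. exact: (big_morph (br^~ y) (brDl y) (br0l y)). Qed.
Let br_sumr y I (s : seq I) F : br y (\sum_(i <- s) F i) = \sum_(i <- s) br y (F i).
Proof. exact: (big_morph (br y) (brDr y) (br0r y)). Qed.

Let br_expand u v :
  br u v = \sum_i \sum_j (coord b i u * coord b j v) *: br b`_i b`_j.
Proof. exact: bilinear_expand. Qed.

Lemma bilinear_bounded : exists2 C, 0 <= C &
  forall u v, coord_norm (br u v) <= C * (coord_norm u * coord_norm v).
Proof.
pose n := \dim {:V}.
exists (\sum_(i < n) \sum_(j < n) coord_norm (br b`_i b`_j)).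
  by apply: sumr_ge0 => i _; apply: sumr_ge0 => j _; exact: coord_norm_ge0.
move=> u v; rewrite br_expand mulr_suml.
apply: le_trans (ler_coord_norm_sum _ _ _) _; apply: ler_sum => i _.
apply: le_trans (ler_coord_norm_sum _ _ _) _; rewrite mulr_suml; apply: ler_sum => j _.
rewrite coord_normZ mulrC ler_wpM2l ?coord_norm_ge0 // normrM.
by apply: ler_pM => //; exact: ler_coord_norm.
Qed.

Let a (A : R) i := A ^+ i / i`!%:R.

Let factSV (F : numFieldType) k : (k.+1`!%:R)^-1 * k.+1%:R = (k`!%:R)^-1 :> F.
Proof. by rewrite factS natrM invfM mulrAC mulVf ?mul1r // pnatr_eq0. Qed.

Let aS A i : a A i.+1 *+ i.+1 = A * a A i.
Proof. by rewrite -mulr_natr /a -mulrA factSV exprS mulrA. Qed.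

Let cauchy_exp A n :
  \sum_(k < n) \sum_(i < k.+1) a A i * a A (k - i) = \sum_(k < n) a (A + A) k.
Proof.
apply: eq_bigr => -[k /= _] _; elim: k => [|k IH].
  by rewrite big_ord1 /a /= !expr0 !fact0 !divr1 mulr1.
have := @cauchy_product_step _ (fun i j => a A i * a A j)
  (fun i j => (A + A) * (a A i * a A j)) k.
rewrite -mulr_sumr IH -mulr_natr -aS -mulr_natr => E.
apply/esym; apply: (@mulIf _ k.+1%:R); first by rewrite pnatr_eq0.
by apply: E => i j; rewrite -mulrnAl aS -mulrnAr aS; ring.
Qed.

Let tail A n := \sum_(i < n) \sum_(n - i <= j < n) a A i * a A j.

(** By the binomial formula the tail is the square of a partial sum of the series of [exp A] minus
    one for [exp (A + A)]; the addition formula makes the limit 0. *)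
Let tail_cvg0 A : tail A @ \oo --> (0 : R).
Proof.
have -> : tail A = (fun n => series (exp_coeff A) n * series (exp_coeff A) n
                       - series (exp_coeff (A + A)) n).
  apply/funext => n; rewrite /tail -(square_sub_triangle (fun i j => a A i * a A j)) cauchy_exp.
  rewrite /series /= !big_mkord; congr (_ - _).
  by rewrite mulr_suml; apply: eq_bigr => i _; rewrite mulr_sumr.
have -> : 0 = expR A * expR A - expR (A + A) :> R by rewrite expRD subrr.
by apply: cvgB; [apply: cvgM|]; exact: is_cvg_series_exp_coeff.
Qed.

(** The Leibniz rule makes the terms for [br y z] the Cauchy product of those for [y] and [z]. The
    error of the partial sums is dominated, term by term, by the scalar [tail]. *)
Lemma exp_derivation_morphism (f e : 'End(V)) :
  (forall y z, f (br y z) = br (f y) z + br y (f z)) -> is_exp f e ->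
  forall y z, e (br y z) = br (e y) (e z).
Proof.
move=> fD eP y z.
pose T v k : V := (k`!%:R : K)^-1 *: iter k f v.
have TS v k : f (T v k) = T v k.+1 *+ k.+1.
  by rewrite /T linearZ /= -[RHS]scaler_nat scalerA mulrC factSV.
have TE k : T (br y z) k = \sum_(i < k.+1) br (T y i) (T z (k - i)%N).
  elim: k => [|k IH]; first by rewrite big_ord1 /T !fact0 invr1 !scale1r.
  have fs : \sum_(i < k.+1) f (br (T y i) (T z (k - i)%N)) = T (br y z) k.+1 *+ k.+1.
    by rewrite -TS IH linear_sum.
  have E : T (br y z) k.+1 *+ k.+1 = (\sum_(i < k.+2) br (T y i) (T z (k.+1 - i)%N)) *+ k.+1.
    rewrite -fs; apply: (@cauchy_product_step _ (fun i j => br (T y i) (T z j))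
      (fun i j => f (br (T y i) (T z j)))) => i j.
    rewrite fD !TS -(scaler_nat i.+1 (T y _)) -(scaler_nat j.+1 (T z _)).
    by rewrite brZl brZr !scaler_nat.
  have : k.+1%:R *: T (br y z) k.+1 = k.+1%:R *: \sum_(i < k.+2) br (T y i) (T z (k.+1 - i)%N).
    by rewrite !scaler_nat.
  by move/(scalerI _); apply; rewrite pnatr_eq0.
pose S v n := \sum_(k < n) T v k.
pose D n := br (S y n) (S z n) - S (br y z) n.
have DE n : D n = \sum_(i < n) \sum_(n - i <= j < n) br (T y i) (T z j).
  rewrite -(square_sub_triangle (fun i j => br (T y i) (T z j))) /D /S; congr (_ - _).
    by rewrite br_suml; apply: eq_bigr => i _; rewrite br_sumr.
  by apply: eq_bigr => k _; exact: TE.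
have [A0 A0_ge0 fA0] := lfun_bounded f.
(* The operator bound is a nonnegative element of [R[i]], hence real; it is moved to [R], where
   [expR] controls the tail. *)
pose A : R := complex.Re A0; have AE : A0 = A%:C%C by rewrite RRe_real // ger0_real.
have A_ge0 : 0 <= A by rewrite -ler0c -AE.
have [C C0 brC] := bilinear_bounded.
have aE i : (a A i)%:C%C = A0 ^+ i / i`!%:R :> K.
  by rewrite AE rmorphM rmorphXn fmorphV rmorph_nat.
have TN v i : coord_norm (T v i) <= (a A i)%:C%C * coord_norm v.
  rewrite /T coord_normZ aE.
  rewrite normfV normr_nat [leRHS]mulrAC [leLHS]mulrC ler_wpM2r ?invr_ge0 ?ler0n //.
  exact: iter_lfun_bounded.
have a_ge0 i : 0 <= a A i by rewrite mulr_ge0 ?exprn_ge0 ?invr_ge0 ?ler0n.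
pose C' := C * (coord_norm y * coord_norm z).
have C'0 : 0 <= C' by rewrite !mulr_ge0 ?coord_norm_ge0.
have DN l n : `|coord b l (D n)| <= C' * (tail A n)%:C%C.
  apply: le_trans (ler_coord_norm _ _) _; rewrite DE /tail rmorph_sum mulr_sumr.
  apply: le_trans (ler_coord_norm_sum _ _ _) _; apply: ler_sum => i _.
  rewrite rmorph_sum mulr_sumr.
  apply: le_trans (ler_coord_norm_sum _ _ _) _; apply: ler_sum => j _.
  apply: le_trans (brC _ _) _; rewrite /C' -mulrA ler_wpM2l // rmorphM /=.
  apply: le_trans (_ : (a A i)%:C%C * coord_norm y * ((a A j)%:C%C * coord_norm z) <= _).
    by apply: ler_pM; rewrite ?coord_norm_ge0.
  by rewrite le_eqVlt; apply/orP; left; apply/eqP; ring.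
apply: (@bilinear_limit _ _ br (S y) (S z) (S (br y z))); first exact: br_expand.
- by move=> i; exact: eP.
- by move=> i; exact: eP.
- by move=> i; exact: eP.
move=> l p p_gt0.
pose ep : R := complex.Re p; pose c : R := complex.Re C'.
have epE : ep%:C%C = p by rewrite RRe_real // gtr0_real.
have cE : c%:C%C = C' by rewrite RRe_real // ger0_real.
have c0 : 0 <= c by rewrite -ler0c cE.
have c1 : 0 < c + 1 by rewrite ltr_wpDl.
have ep0 : 0 < ep by rewrite -ltcR epE.
have [n2 _ n2P] := (cvgrPdist_lt _ _).1 (tail_cvg0 A) _ (divr_gt0 ep0 c1).
exists n2 => n /n2P /=; rewrite sub0r normrN => tail_lt.
rewrite -/(D n); apply: (le_lt_trans (DN l n)); rewrite -cE -epE -rmorphM ltcR.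
apply: (@le_lt_trans _ _ (c * `|tail A n|)); first by rewrite ler_wpM2l // ler_norm.
apply: (@le_lt_trans _ _ ((c + 1) * `|tail A n|)); first by rewrite ler_wpM2r // lerDl.
by rewrite mulrC -ltr_pdivlMr.
Qed.

End ExpMorphism.

(** * Tensors, and derivatives of one-parameter groups *)

Section Contraction.
Context {K : numFieldType} {g : vectType K}.
Local Notation b := (vbasis {:g}).

(** The linear map on tensors induced by a bilinear [beta], that is the universal property in
    coordinates. *)
Definition tcontr (W : lmodType K) (beta : g -> g -> W) (Y : tensor g g) : W :=
  \sum_i \sum_j Y i j *: beta b`_i b`_j.

Lemma tcontr_linear (W : lmodType K) (beta : g -> g -> W) : linear (tcontr beta).
Proof.
move=> c Y Z; rewrite /tcontr scaler_sumr -big_split /=; apply: eq_bigr => i _.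
rewrite scaler_sumr -big_split /=; apply: eq_bigr => j _.
by rewrite !mxE scalerDl scalerA.
Qed.

Lemma eq_tcontr (W : lmodType K) (beta beta' : g -> g -> W) Y :
  (forall u v, beta u v = beta' u v) -> tcontr beta Y = tcontr beta' Y.
Proof. by move=> E; apply: eq_bigr => i _; apply: eq_bigr => j _; rewrite E. Qed.

HB.instance Definition _ (W : lmodType K) (beta : g -> g -> W) :=
  GRing.isLinear.Build K (tensor g g) W *:%R (tcontr beta) (tcontr_linear beta).

Lemma tcontr_tens (W : lmodType K) (beta : g -> g -> W) :
  (forall v, linear (beta^~ v)) -> (forall u, linear (beta u)) ->
  forall u v, tcontr beta (tens u v) = beta u v.
Proof.
move=> betal betar u v; rewrite [RHS](bilinear_expand betal betar) /tcontr.
by apply: eq_bigr => i _; apply: eq_bigr => j _; rewrite mxE.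
Qed.

Lemma tcontr_map (W : lmodType K) (beta : g -> g -> W) (f f' : 'End(g)) Y :
  (forall v, linear (beta^~ v)) -> (forall u, linear (beta u)) ->
  tcontr beta (tens_map f f' Y) = tcontr (fun u v => beta (f u) (f' v)) Y.
Proof.
move=> betal betar; rewrite /tens_map linear_sum; apply: eq_bigr => i _.
rewrite linear_sum; apply: eq_bigr => j _.
by rewrite linearZ /= (tcontr_tens betal betar).
Qed.

Lemma tcontr_lin (W W' : vectType K) (F : 'Hom(W, W')) (beta : g -> g -> W) Y :
  F (tcontr beta Y) = tcontr (fun u v => F (beta u v)) Y.
Proof.
rewrite linear_sum; apply: eq_bigr => i _; rewrite linear_sum.
by apply: eq_bigr => j _; rewrite linearZ.
Qed.

Lemma tens_linearl v : linear ((@tens K g g)^~ v).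
Proof. by move=> c u w; apply/matrixP => i j; rewrite !mxE linearP mulrDl mulrA. Qed.

Lemma tens_linearr u : linear (@tens K g g u).
Proof. by move=> c v w; apply/matrixP => i j; rewrite !mxE linearP mulrDr mulrCA. Qed.

Lemma tens_space_ind (A B : {vspace g}) (P : tensor g g -> Prop) :
  P 0 -> (forall c Y Z, P Y -> P Z -> P (c *: Y + Z)) ->
  (forall u v, u \in A -> v \in B -> P (tens u v)) ->
  forall Y, Y \in tens_space A B -> P Y.
Proof.
move=> P0 PL PT Y YV; have [D DP] := ex_vspace P0 PL; apply/DP.
apply: (subvP _ Y YV); apply/span_subvP => _ /allpairsP[[u v] /= [uA vB ->]].
by apply/DP/PT; exact: vbasis_mem.
Qed.

Lemma tensor_coord (Y : tensor g g) i j :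
  Y i j = tcontr (fun u v => coord b i u * coord b j v : K^o) Y.
Proof.
rewrite /tcontr (bigD1 i) //= (bigD1 j) //=.
have fb := basis_free (vbasisP {:g}).
rewrite !coord_free // !eqxx mulr1 !big1 ?addr0.
- by rewrite [_ *: _]mulr1.
- move=> k ki; rewrite big1 // => l _.
  by rewrite !coord_free // (negPf ki) mul0r scaler0.
- by move=> l lj; rewrite !coord_free // (negPf lj) mulr0 scaler0.
Qed.

Lemma tens_pairE (kU kV : g -> g -> K) s t :
  tens_pair kU kV s t = tcontr (fun u v => tcontr (fun u' v' => kU u u' * kV v v' : K^o) t : K^o) s.
Proof.
apply: eq_bigr => i _; apply: eq_bigr => j _; rewrite /tcontr scaler_sumr.
apply: eq_bigr => k _; rewrite scaler_sumr; apply: eq_bigr => l _.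
by rewrite scalerA.
Qed.

(** Membership becomes the vanishing of scalar linear forms, to which first-order expansions
    apply. *)
Lemma memv_coord_proj (W : vectType K) (A : {vspace W}) w :
  (forall i, coord (vbasis {:W}) i (w - projv A w) = 0) -> w \in A.
Proof.
move=> w0; suff -> : w = projv A w by exact: memv_proj.
apply/eqP; rewrite -subr_eq0; apply/eqP; rewrite (vbasis_expand (_ - _)) big1 // => i _.
by rewrite w0 scale0r.
Qed.

End Contraction.

(** * From a one-parameter group to its generator *)

Section GroupToLie.
Context {K : numFieldType} {g : vectType K} (f : 'End(g)) (e : K -> 'End(g)).
Context (eP : forall t, is_exp (t *: f) (e t)).

Lemma first_order_linear (l : g -> K) : scalar l ->
  forall v, first_order (fun t => l (e t v)) (l v) (l (f v)).
Proof.
move=> l_lin v; have [F FE] := @ex_lfun K g K^o l l_lin.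
have lE w : l w = \sum_i coord (vbasis {:g}) i w * l (vbasis {:g})`_i.
  rewrite -!FE {1}(vbasis_expand w) linear_sum; apply: eq_bigr => i _.
  by rewrite linearZ /= FE.
rewrite (lE v) (lE (f v)) (_ : (fun t => _) = fun t =>
    \sum_i coord (vbasis {:g}) i (e t v) * l (vbasis {:g})`_i).
  apply: first_order_sum => i; rewrite ![_ * l _]mulrC.
  rewrite (_ : (fun t => _) = fun t => l (vbasis fullv)`_i * coord (vbasis {:g}) i (e t v)).
    exact/first_order_scale/exp_first_order.
  by apply/funext => t; rewrite mulrC.
by apply/funext => t; rewrite {1}lE.
Qed.

Lemma first_order_bilinear (beta : g -> g -> K) :
  (forall v, scalar (beta^~ v)) -> (forall u, scalar (beta u)) ->
  forall u v, first_order (fun t => beta (e t u) (e t v)) (beta u v)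
    (beta u (f v) + beta (f u) v).
Proof.
move=> betal betar u v.
have E x y : beta x y = \sum_i \sum_j (coord (vbasis {:g}) i x * coord (vbasis {:g}) j y)
    * beta (vbasis {:g})`_i (vbasis {:g})`_j.
  exact: (@bilinear_expand K g K^o beta betal betar).
rewrite (E u v) (E u (f v)) (E (f u) v) -big_split /=.
rewrite (_ : (fun t => _) = fun t => \sum_i \sum_j
    (coord (vbasis {:g}) i (e t u) * coord (vbasis {:g}) j (e t v))
    * beta (vbasis {:g})`_i (vbasis {:g})`_j); last by apply/funext => t; exact: E.
apply: first_order_sum => i; rewrite -big_split /=; apply: first_order_sum => j.
rewrite -mulrDl ![_ * beta _ _]mulrC.
rewrite (_ : (fun t => _) = fun t => beta (vbasis {:g})`_i (vbasis {:g})`_j *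
   (coord (vbasis {:g}) i (e t u) * coord (vbasis {:g}) j (e t v))).
  by apply: first_order_scale; apply: first_order_mul; exact: exp_first_order.
by apply/funext => t; rewrite mulrC.
Qed.

(** The Lie algebra action on the tensor square, the derivative at 0 of [e t] acting on both
    factors. *)
Definition tens_der (Y : tensor g g) : tensor g g :=
  tens_map f \1%VF Y + tens_map \1%VF f Y.

Lemma first_order_tensor (l : tensor g g -> K) : scalar l ->
  forall Y, first_order (fun t => l (tens_map (e t) (e t) Y)) (l Y) (l (tens_der Y)).
Proof.
move=> l_lin Y; have [F FE] := @ex_lfun K (tensor g g) K^o l l_lin.
have lE f1 f2 : l (tens_map f1 f2 Y) = \sum_i \sum_j Y i j *
    l (tens (f1 (vbasis {:g})`_i) (f2 (vbasis {:g})`_j)).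
  rewrite -FE linear_sum; apply: eq_bigr => i _; rewrite linear_sum.
  by apply: eq_bigr => j _; rewrite linearZ /= FE.
have l1 : l Y = \sum_i \sum_j Y i j * l (tens (vbasis {:g})`_i (vbasis {:g})`_j).
  rewrite -[in LHS](_ : tens_map \1%VF \1%VF Y = Y).
    by rewrite lE; apply: eq_bigr => i _; apply: eq_bigr => j _; rewrite !id_lfunE.
  apply/matrixP => i j; rewrite [LHS]tensor_coord [RHS]tensor_coord tcontr_map.
  - by apply: eq_tcontr => u v; rewrite !id_lfunE.
  - by move=> v c u w /=; rewrite linearP mulrDl -mulrA.
  - by move=> u c v w /=; rewrite linearP mulrDr mulrCA.
have -> : l (tens_der Y) = \sum_i \sum_j Y i j *
    (l (tens (vbasis {:g})`_i (f (vbasis {:g})`_j)) + l (tens (f (vbasis {:g})`_i) (vbasis {:g})`_j)).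
  rewrite /tens_der -FE linearD /= !FE !lE -big_split; apply: eq_bigr => i _ /=.
  by rewrite -big_split; apply: eq_bigr => j _ /=; rewrite !id_lfunE mulrDr addrC.
rewrite l1 (_ : (fun t => _) = fun t => \sum_i \sum_j Y i j *
    l (tens (e t (vbasis {:g})`_i) (e t (vbasis {:g})`_j))); last by apply/funext => t; exact: lE.
apply: first_order_sum => i; apply: first_order_sum => j; apply: first_order_scale.
apply: (@first_order_bilinear (fun u v => l (tens u v))).
- by move=> v c u w; rewrite -!FE tens_linearl linearP.
- by move=> u c v w; rewrite -!FE tens_linearr linearP.
Qed.

(** A linear form vanishing on [W] is constantly 0 along [e t w]; by uniqueness of the expansion it
    also vanishes at [f w]. *)
Lemma exp_stable (W : {vspace g}) : (forall t w, w \in W -> e t w \in W) ->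
  forall w, w \in W -> f w \in W.
Proof.
move=> eW w wW; apply: memv_coord_proj => i.
pose l v := coord (vbasis {:g}) i (v - projv W v).
have l_lin : scalar l.
  by move=> c u v; rewrite /l linearP opprD addrACA -scalerBr linearP.
have lW v : v \in W -> l v = 0 by move=> vW; rewrite /l projv_id // subrr linear0.
have := first_order_linear l_lin w.
rewrite (_ : (fun t => _) = fun=> 0); last by apply/funext => t; rewrite lW // eW.
by move=> /first_order_uniq /(_ (first_order_const 0)).
Qed.

Lemma exp_tensor_stable (W : {vspace tensor g g}) :
  (forall t Y, Y \in W -> tens_map (e t) (e t) Y \in W) ->
  forall Y, Y \in W -> tens_der Y \in W.
Proof.
move=> eW w wW; apply: memv_coord_proj => i.
pose l v := coord (vbasis {:tensor g g}) i (v - projv W v).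
have l_lin : scalar l.
  by move=> c u v; rewrite /l linearP opprD addrACA -scalerBr linearP.
have lW v : v \in W -> l v = 0 by move=> vW; rewrite /l projv_id // subrr linear0.
have := first_order_tensor l_lin w.
rewrite (_ : (fun t => _) = fun=> 0); last by apply/funext => t; rewrite lW // eW.
by move=> /first_order_uniq /(_ (first_order_const 0)).
Qed.

Lemma exp_equivariant (F : 'Hom(tensor g g, g)) Y :
  (forall t, F (tens_map (e t) (e t) Y) = e t (F Y)) -> F (tens_der Y) = f (F Y).
Proof.
move=> FeY; rewrite (vbasis_expand (F _)) (vbasis_expand (f _)).
apply: eq_bigr => i _; congr (_ *: _).
have c_lin : scalar (fun v => coord (vbasis {:g}) i v) by move=> c u v; rewrite linearP.
have cF_lin : scalar (fun Z => coord (vbasis {:g}) i (F Z)) by move=> c u v; rewrite !linearP.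
have := first_order_tensor cF_lin Y.
rewrite (_ : (fun t => _) = fun t => coord (vbasis fullv) i (e t (F Y))).
  by move=> /first_order_uniq /(_ (first_order_linear c_lin (F Y))).
by apply/funext => t; rewrite FeY.
Qed.

End GroupToLie.

(** * The adjoint group acts by automorphisms *)

Section AdGroup.
Context {R : realType} {g : vectType R[i]} (br : lieBracket g).

Lemma exp_fixed (K : numFieldType) (V : vectType K) (f e : 'End(V)) v :
  is_exp f e -> f v = 0 -> e v = v.
Proof.
move=> eP fv0; rewrite (vbasis_expand (e v)) [RHS](vbasis_expand v).
apply: eq_bigr => i _; congr (_ *: _); apply/eqP; rewrite -subr_eq0 -normr_le0.
apply: (@cvg_dist_le _ _ _ _ _ 1 (eP v i)) => // n.
rewrite add1n big_ord_recl big1 => [|k _].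
  by rewrite fact0 invr1 scale1r addr0 subrr normr0.
suff -> : iter (lift ord0 k) f v = 0 by rewrite scaler0.
by rewrite lift0 iterSr fv0; elim: (k : nat) => //= n' ->; rewrite linear0.
Qed.

Lemma exp_ad_morphism x e : is_exp (ad br x) e ->
  forall y z, e (br y z) = br (e y) (e z).
Proof.
apply: exp_derivation_morphism; [exact: bracket_linearl | exact: bracket_linearr |].
by move=> y z; rewrite !adE br_br.
Qed.

(** Injectivity is part of [H] so that inverses stay in [H]. For an exponential it comes from
    simplicity, the kernel of a morphism being an ideal. *)
Lemma Ad_group_morphism f : is_simple br -> Ad_group br f ->
  forall y z, f (br y z) = br (f y) (f z).
Proof.
move=> g_simple.
pose H : set 'End(g) := [set f | lker f == 0%VS /\ forall y z, f (br y z) = br (f y) (f z)].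
suff AH : Ad_group br `<=` H by move=> /AH[].
move=> {}f; apply => [|e [x eP]].
  split.
  - split=> [|y z]; last by rewrite !id_lfunE.
    by apply/lker0P => u v; rewrite !id_lfunE.
  - move=> f1 f2 [/lker0P i1 m1] [/lker0P i2 m2]; split=> [|y z].
      by apply/lker0P => u v; rewrite !comp_lfunE => /i1/i2.
    by rewrite !comp_lfunE m2 m1.
  move=> f1 [k1 m1]; exists (f1^-1)%VF; last by rewrite lker0_compfV // lker0_compVf.
  have kV : lker (f1^-1)%VF == 0%VS.
    by apply/lker0P => u v /(congr1 f1); rewrite !lker0_lfunVK.
  move/lker0P: (k1) => inj1; split=> // y z; apply: inj1.
  by rewrite m1 !lker0_lfunVK.
have em := exp_ad_morphism eP; split => //.
have [ideal0|ideal1] : lker e = 0%VS \/ lker e = fullv.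
- by case: g_simple => _; apply=> u v; rewrite !memv_ker em => /eqP ->; rewrite br0r.
- by rewrite ideal0.
(* The kernel cannot be everything: [e] fixes [x], so [x] would be 0, and the exponential of 0 fixes
   every vector. *)
have ex : e x = x by apply: exp_fixed eP _; rewrite adE bracketxx.
have x0 : x = 0 by apply/eqP; rewrite -ex -memv_ker ideal1 memvf.
apply/lker0P => u v.
by rewrite !(exp_fixed eP) // x0 adE br0l.
Qed.

End AdGroup.

(** * The grading of a maximal parabolic *)

Section Parabolic.
Context {K : numFieldType} {g : vectType K} {br : lieBracket g}.
Context {h : {vspace g}} (h_cartan : is_cartan br h).
Context {Delta : seq (dual h)} (DeltaP : lists_roots br Delta).
Context {r : nat} {Pi : r.-tuple (dual h)} (PiP : is_base Delta Pi).

(** Biduality: a coordinate along [Pi] is a form on the dual of [h], hence an evaluation. *)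
Lemma ex_coweight j : exists H : subvs_of h, forall b : dual h, b H = coord Pi j b :> K.
Proof.
apply: (@ex_pairing_rep K (subvs_of h) (dual h) (fun H b => b H : K)).
- by move=> H c a b /=; rewrite add_lfunE scale_lfunE.
- by move=> b c H1 H2 /=; rewrite linearP.
- by rewrite !dimvf /= [RHS]muln1.
- move=> H H0; rewrite (vbasis_expand H) big1 // => i _.
  have [|a aE] := @ex_lfun K (subvs_of h) K^o (coord (vbasis {:subvs_of h}) i).
    by move=> c u v; rewrite linearP.
  by have := H0 a; rewrite aE => ->; rewrite scale0r.
by move=> c a b; rewrite linearP.
Qed.

Context {E : 'I_r -> subvs_of h}.
Context (EP : forall j (b : dual h), b (E j) = coord Pi j b :> K).

Lemma simple_root_coweight i j : tnth Pi i (E j) = (i == j)%:R :> K.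
Proof.
case: PiP => /basis_free fPi _ _.
by rewrite EP (tnth_nth 0) coord_free.
Qed.

Lemma simple_root_mem i : tnth Pi i \in Delta.
Proof. by case: PiP => _ PiD _; apply: PiD; exact: mem_tnth. Qed.

Lemma base_sum b : b \in Delta -> exists c : 'I_r -> nat,
  b = \sum_i tnth Pi i *+ c i \/ b = - \sum_i tnth Pi i *+ c i.
Proof. by case: PiP => _ _; apply. Qed.

Context (q : 'I_r).
Local Notation deg := (in_degree (br := br) E q).

(** Degrees are integers by the sign condition on roots. In a field like the complex numbers squares
    need not be nonnegative, so this has to be stated. *)
Lemma degree_square_ge0 c x : deg c x -> x != 0 -> 0 <= c ^+ 2.
Proof.
move=> xc x0; apply: contraT => c2; case/eqP: x0; move: x xc.
apply: (in_degree_ind h_cartan) => [//|k u v -> ->|b x xb bc].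
  by rewrite scaler0 addr0.
apply/eqP; apply: contraNT c2 => x0; rewrite -bc.
have [->|b0] := eqVneq b 0; first by rewrite zero_lfunE expr0n.
have [d [->|->]] := base_sum (mem_roots DeltaP xb x0 b0).
  by rewrite (sum_simple_roots simple_root_coweight) exprn_ge0 // ler0n.
by rewrite dualNE (sum_simple_roots simple_root_coweight) sqrrN exprn_ge0 // ler0n.
Qed.

(** In an eigenbasis of [ad (E q)] the value is a sum of nonnegative squares. If it vanished,
    [ad (E q)] would be 0, but it is the identity on the root space of the [q]-th simple root. *)
Lemma killing_coweight_neq0 : killing br (vsval (E q)) (vsval (E q)) != 0.
Proof.
have [s bs sP] : lf_diagonalizable (ad br (vsval (E q))).
  by case: h_cartan => _ _; apply; exact: subvsP.
pose t := in_tuple s; pose f := ad br (vsval (E q)).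
have tP (i : 'I_(size s)) : exists c, f t`_i = c *: t`_i by apply: sP; rewrite mem_nth.
have t0 (i : 'I_(size s)) : t`_i != 0.
  by apply: (free_not0 (basis_free bs)); rewrite mem_nth.
have -> : killing br (vsval (E q)) (vsval (E q)) = trace_in t (f \o f)%VF.
  exact: (@trace_in_basis _ _ _ _ _ _ (f \o f)%VF (vbasisP fullv)).
apply/eqP => tr0.
have sq_ge0 (i : 'I_(size s)) : 0 <= coord t i ((f \o f)%VF t`_i).
  have [c fc] := tP i; rewrite comp_lfunE fc linearZ /= fc scalerA linearZ /=.
  rewrite coord_free ?(basis_free bs) // eqxx mulr1 -expr2.
  by apply: (@degree_square_ge0 c t`_i) => //; rewrite /in_degree -adE.
have f0 : f = 0.
  apply/(fullv_lfunP _ _ (span_basis bs)) => v vs; rewrite zero_lfunE.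
  have [i ->] : exists i : 'I_(size s), v = t`_i.
    have vi : (index v s < size s)%N by rewrite index_mem.
    by exists (Ordinal vi); rewrite /= nth_index.
  have [c fc] := tP i.
  have := psumr_eq0P (fun i _ => sq_ge0 i) tr0 (i := i) isT.
  rewrite comp_lfunE fc linearZ /= fc scalerA linearZ /=.
  rewrite coord_free ?(basis_free bs) // eqxx mulr1.
  by move/eqP; rewrite mulf_eq0 orbb => /eqP ->; rewrite scale0r.
have [x xq x0] := root_vector DeltaP (simple_root_mem q).
case/eqP: x0; have := in_degree_root E q xq.
rewrite /in_degree -adE -/f f0 zero_lfunE simple_root_coweight eqxx scale1r.
by move=> <-.
Qed.

Lemma killing_nondegenerate : is_simple br ->
  forall x, (forall y, killing br x y = 0) -> x = 0.
Proof. by move=> g_simple; apply: simple_killing_nondegenerate killing_coweight_neq0. Qed.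

Lemma gradingP (j : int) x :
  x \in grading br Delta Pi q j <-> deg j%:~R x.
Proof.
split=> [xg|].
  have [B BP] := ex_vspace (in_degree0 (br := br) E q j%:~R) (in_degreeP (k := j%:~R)).
  apply/BP; apply: (subvP _ x xg); rewrite subv_add; apply/andP; split.
    case: eqP => [j0|_]; last exact: sub0v.
    apply/subvP => y yh; apply/BP; rewrite /in_degree j0 mulr0z scale0r -(vsprojK yh).
    exact: (cartan_abelian h_cartan).
  apply: subv_sum_seqP => b bD /eqP bq; apply/subvP => y yb; apply/BP.
  by rewrite -bq -EP; exact: in_degree_root.
move: x; apply: (in_degree_ind h_cartan) => [|c u v uG vG|b x xb bj]; first exact: mem0v.
  by rewrite memvD ?memvZ.
have [->|x0] := eqVneq x 0; first exact: mem0v.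
have [b0|b0] := eqVneq b 0.
  apply: (subvP (addvSl _ _)); move: bj; rewrite b0 zero_lfunE => /esym/eqP.
  by rewrite intr_eq0 => ->; rewrite -(root_space0 h_cartan) -b0.
apply: (subvP (addvSr _ _)); apply: (memv_sum_seq _ _ xb); first exact: (mem_roots DeltaP xb x0 b0).
by rewrite -EP bj.
Qed.

Lemma degree0_levi x : deg 0 x -> x \in levi br Delta Pi q.
Proof.
move: x; apply: (in_degree_ind h_cartan) => [|c u v uG vG|b x xb b_q]; first exact: mem0v.
  by rewrite memvD ?memvZ.
have [->|x0] := eqVneq x 0; first exact: mem0v.
have [b0|b0] := eqVneq b 0.
  by apply: (subvP (addvSl _ _)); rewrite -(root_space0 h_cartan) -b0.
apply: (subvP (addvSr _ _)); apply: (memv_sum_seq _ _ xb); first exact: (mem_roots DeltaP xb x0 b0).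
have bPi : basis_of fullv Pi by case: PiP.
rewrite /in_levi (coord_basis bPi (memvf b)) rpred_sum // => i _.
have [->|iq] := eqVneq i q; first by rewrite -EP b_q scale0r mem0v.
rewrite memvZ // memv_span // mem_filter mem_nth ?size_tuple // andbT.
by rewrite (tnth_nth 0) nth_uniq ?size_tuple // (free_uniq (basis_free bPi)).
Qed.

Lemma degree1_nilrad x : deg 1 x -> x \in nilrad br Delta Pi q.
Proof.
move: x; apply: (in_degree_ind h_cartan) => [|c u v uG vG|b x xb b_q]; first exact: mem0v.
  by rewrite memvD ?memvZ.
have [->|x0] := eqVneq x 0; first exact: mem0v.
have b0 : b != 0.
  by apply/eqP => b0; move: b_q; rewrite b0 zero_lfunE => /esym/eqP; rewrite oner_eq0.
have bD := mem_roots DeltaP xb x0 b0.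
apply: (memv_sum_seq bD _ xb); apply/andP; split.
  apply/forallP => i; rewrite -EP.
  have [|b_le0] := root_signs simple_root_coweight base_sum bD; first exact.
  by have := b_le0 q; rewrite b_q ler10.
apply/negP => /= bl; have : b (E q) = 0 :> K.
  have [||B BP] := @ex_vspace K (dual h) (fun c : dual h => c (E q) = 0 :> K).
  - exact: zero_lfunE.
  - by move=> c u v u0 v0; rewrite add_lfunE scale_lfunE u0 v0 scaler0 addr0.
  apply/BP; apply: (subvP _ _ bl); apply/span_subvP => a.
  rewrite mem_filter => /andP[aq /tnthP[i ai]]; apply/BP.
  rewrite ai simple_root_coweight; case: eqP => // iq.
  by rewrite ai iq eqxx in aq.
by rewrite b_q => /eqP; rewrite oner_eq0.
Qed.

Lemma mem_lie_prod (A B : {vspace g}) x y :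
  x \in A -> y \in B -> br x y \in lie_prod br A B.
Proof.
move=> xA yB; rewrite (coord_vbasis xA) br_suml rpred_sum // => i _.
rewrite brZl memvZ // (coord_vbasis yB) linear_sum rpred_sum // => j _.
rewrite linearZ memvZ // memv_span //; apply/allpairsP.
by exists ((vbasis A)`_i, (vbasis B)`_j); rewrite /= !mem_nth ?size_tuple.
Qed.

Lemma quasi_heisenberg_degree1 : quasi_heisenberg br Delta Pi q ->
  forall x y z, deg 1 x -> deg 1 y -> deg 1 z -> br x (br y z) = 0.
Proof.
move=> [n3 _] x y z /degree1_nilrad xn /degree1_nilrad yn /degree1_nilrad zn.
by apply/eqP; rewrite -memv0 -n3; do 2!apply: mem_lie_prod => //.
Qed.

End Parabolic.

(** * The map tau1 *)

Section Tau.
Context {K : numFieldType} {g : vectType K} {br : lieBracket g}.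
Context (g_simple : is_simple br).
Context {h : {vspace g}} (h_cartan : is_cartan br h).
Context {Delta : seq (dual h)} (DeltaP : lists_roots br Delta).
Context {r : nat} {Pi : r.-tuple (dual h)} (PiP : is_base Delta Pi).
Context (q : 'I_r) (q_qH : quasi_heisenberg br Delta Pi q).
Context {m : nat} {X Xs : m.-tuple g} (XXs : dual_bases br Delta Pi q X Xs).
Context {E : 'I_r -> subvs_of h}.
Context (EP : forall j (b : dual h), b (E j) = coord Pi j b :> K).
Local Notation deg := (in_degree (br := br) E q).
Local Notation g1 := (grading br Delta Pi q 1).
Local Notation gm2 := (grading br Delta Pi q (-2)).
Local Notation kap := (killing br).

Let nd := killing_nondegenerate h_cartan DeltaP PiP EP q g_simple.
Let aE := simple_root_coweight PiP EP.
Let aD := simple_root_mem PiP.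
Let sgn := base_sum PiP.

Let grad1 x : x \in g1 <-> deg 1 x.
Proof. exact: (gradingP h_cartan DeltaP EP q 1). Qed.

Let gradm2 x : x \in gm2 <-> deg (- 2%:R) x.
Proof. by have := gradingP h_cartan DeltaP EP q (-2) x; rewrite mulrNz. Qed.

Let grad2 x : x \in grading br Delta Pi q 2 <-> deg 2%:R x.
Proof. exact: (gradingP h_cartan DeltaP EP q 2). Qed.

Lemma dual_basis_expand2 u : deg 2%:R u ->
  u = \sum_k kap u (tnth Xs k) *: tnth X k.
Proof.
have [bX bXs kX] := XXs; move=> /grad2 ug.
rewrite {1}(coord_basis bX ug); apply: eq_bigr => k _; rewrite -tnth_nth; congr (_ *: _).
rewrite {2}(coord_basis bX ug) killing_suml (bigD1 k) //= big1 => [|j jk].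
  by rewrite killingZl killingC -tnth_nth kX eqxx mulr1 addr0.
by rewrite killingZl killingC -tnth_nth kX eq_sym (negPf jk) mulr0.
Qed.

Lemma dual_basis_expandN2 u : deg (- 2%:R) u ->
  u = \sum_k kap u (tnth X k) *: tnth Xs k.
Proof.
have [bX bXs kX] := XXs; move=> /gradm2 ug.
rewrite {1}(coord_basis bXs ug); apply: eq_bigr => k _; rewrite -tnth_nth; congr (_ *: _).
rewrite {2}(coord_basis bXs ug) killing_suml (bigD1 k) //= big1 => [|j jk].
  by rewrite killingZl -tnth_nth kX eqxx mulr1 addr0.
by rewrite killingZl -tnth_nth kX (negPf jk) mulr0.
Qed.

Lemma tau1_tildeE Y x : tau1_tilde br X Xs Y x =
  tcontr (fun u v => \sum_k kap u (br x (tnth Xs k)) * kap v (tnth X k) : K^o) Y.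
Proof.
rewrite /tau1_tilde tens_pairE; apply: eq_tcontr => u v.
rewrite /tau1 tcontr_map /omega.
- rewrite linear_sum; apply: eq_bigr => k _; rewrite /= tcontr_tens.
  + by rewrite adE id_lfunE.
  + by move=> w c y z /=; rewrite linearP linearP mulrDl -mulrA.
  + by move=> y c w z /=; rewrite linearP linearP mulrDr mulrCA.
- by move=> w c y z /=; rewrite linearP mulrDl -mulrA.
- by move=> y c w z /=; rewrite linearP mulrDr mulrCA.
Qed.

(** The map phi of the overview, extended to all tensors. *)
Definition bracket_contr : tensor g g -> g := tcontr (fun u v => br v u).

HB.instance Definition _ :=
  GRing.isLinear.Build K (tensor g g) g *:%R bracket_contr (tcontr_linear (fun u v => br v u)).

Lemma bracket_contr_tens u v : bracket_contr (tens u v) = br v u.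
Proof.
by apply: tcontr_tens => [w|w]; [exact: bracket_linearr | exact: bracket_linearl].
Qed.

(** On [tens u v] the sum over the dual bases reassembles [v] and leaves [kap u (br x v)];
    invariance does the rest. *)
Lemma tau1_tilde_bracket Y x : Y \in tens_space g1 gm2 ->
  tau1_tilde br X Xs Y x = kap (bracket_contr Y) x.
Proof.
move: Y; apply: tens_space_ind => [|c Y Z YE ZE|u v /grad1 u1 /gradm2 v2].
- by rewrite tau1_tildeE !linear0 killing0l.
- by rewrite tau1_tildeE linearP /= -!tau1_tildeE YE ZE linearP killingDl killingZl.
rewrite tau1_tildeE bracket_contr_tens tcontr_tens.
- transitivity (kap u (br x v)).
    rewrite [in RHS](dual_basis_expandN2 v2) !linear_sum; apply: eq_bigr => k _ /=.
    by rewrite brZr killingZr mulrC.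
  by rewrite brC linearN /= -killing_br brC killingNl opprK.
- move=> w c y z /=; rewrite [X in _ = X + _]mulr_sumr -big_split; apply: eq_bigr => k _ /=.
  by rewrite killingDl killingZl mulrDl mulrA.
- move=> y c w z /=; rewrite [X in _ = X + _]mulr_sumr -big_split; apply: eq_bigr => k _ /=.
  by rewrite killingDl killingZl mulrDr mulrCA.
Qed.

Lemma bracket_contr_degree Y : Y \in tens_space g1 gm2 -> deg (-1) (bracket_contr Y).
Proof.
move: Y; apply: tens_space_ind => [|c Y Z YE ZE|u v /grad1 u1 /gradm2 v2].
- by rewrite linear0; exact: in_degree0.
- by rewrite linearP; exact: in_degreeP.
rewrite bracket_contr_tens.
by have := in_degree_br v2 u1; rewrite -[- 2%:R + 1]opprK opprD opprK -[2%:R]natr1 addrK.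
Qed.

Lemma degreeN1_nondegenerate y : deg (-1) y -> (forall x, deg 1 x -> kap y x = 0) -> y = 0.
Proof.
move=> y1 y0; apply: nd; apply: (weight_ind_full h_cartan) => [|c u v u0 v0|b z zb].
- exact: linear0.
- by rewrite linearD /= killingZr u0 v0 mulr0 addr0.
have [bq|bq] := eqVneq (b (E q) : K) 1.
  by apply: y0; have := in_degree_root E q zb; rewrite bq.
have := killing_brN br (vsval (E q)) y z.
rewrite y1 (in_degree_root E q zb) killingZl killingZr mulN1r => /oppr_inj/esym/eqP.
rewrite -subr_eq0 -{2}[kap y z]mul1r -mulrBl mulf_eq0 subr_eq0.
by rewrite (negPf bq) => /eqP.
Qed.

(** From this g(-2) is nonzero, which makes the dual bases nonempty and the bracket nonzero on
    g(-1). *)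
Lemma ex_degreeN2 (V : {vspace tensor g g}) : (V <= tens_space g1 gm2)%VS -> V != 0%VS ->
  exists2 z, deg (- 2%:R) z & z != 0.
Proof.
move=> V_sub V0; apply: contrapT => nex.
have z0 z : deg (- 2%:R) z -> z = 0.
  by move=> z2; apply/eqP; apply: contraT => zn0; case: nex; exists z.
case/negP: V0; rewrite -subv0; apply/subvP => Y /(subvP V_sub) YT; rewrite memv0.
apply/eqP; move: Y YT; apply: tens_space_ind => [//|c Y Z -> ->|u v _ /gradm2/z0 ->].
  by rewrite scaler0 addr0.
by apply/matrixP => i j; rewrite !mxE linear0 mulr0.
Qed.

Lemma equivariant_tau1_neq0 (V : {vspace tensor g g}) (F : 'Hom(tensor g g, g)) :
  (V <= tens_space g1 gm2)%VS -> V != 0%VS ->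
  (forall x Y, deg 0 x -> Y \in V -> tens_der (ad br x) Y \in V) ->
  (forall x Y, deg 0 x -> Y \in V -> F (tens_der (ad br x) Y) = br x (F Y)) ->
  (forall y, y \in (F @: V)%VS <-> deg (-1) y) -> (V :&: lker F)%VS = 0%VS ->
  ~ (forall Y, Y \in V -> forall x, x \in g1 -> tau1_tilde br X Xs Y x = 0).
Proof.
move=> V_sub V0 V_stab F_eq F_im F_inj tau0.
have [z z2 z0] := ex_degreeN2 V_sub V0.
have m_gt0 : (0 < m)%N.
  rewrite lt0n; apply: contraNneq z0 => m0; rewrite (dual_basis_expandN2 z2) big1 //.
  by move=> [i i_lt] _; exfalso; rewrite m0 in i_lt.
have br_neq0 : exists u w, [/\ deg (-1) u, deg (-1) w & br u w != 0].
  apply: contrapT => nex; case/eqP: z0.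
  apply: (degreeN2_eq0 h_cartan DeltaP nd aE aD sgn _ z2) => u w u1 w1.
  by apply/eqP; apply: contraT => uw0; case: nex; exists u, w.
have Finj Y Z : Y \in V -> Z \in V -> F Y = F Z -> Y = Z.
  move=> YV ZV FYZ; apply/eqP; rewrite -subr_eq0 -memv0 -F_inj memv_cap memvB //=.
  by rewrite memv_ker linearB /= FYZ subrr.
(* [G] is the inverse of the isomorphism, with values in [V]: composing with the projection makes
   [F'] have image [F @: V], where its pseudo-inverse is a right inverse. *)
pose F' := (F \o projv V)%VF; pose G := (projv V \o F'^-1)%VF.
have GV y : G y \in V by rewrite comp_lfunE memv_proj.
have FG y : deg (-1) y -> F (G y) = y.
  move=> /F_im yF; rewrite /G comp_lfunE -[F _]comp_lfunE limg_lfunVK //.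
  by rewrite limg_comp limg_proj.
have G_eq x y : deg 0 x -> deg (-1) y -> G (br x y) = tens_der (ad br x) (G y).
  move=> x0 y1; apply: Finj => //; first exact: V_stab.
  rewrite F_eq // !FG // -[-1]add0r; exact: in_degree_br.
pose Psi u w := tcontr (fun a b => kap a w *: b) (G u).
have Psi_l w v : linear (fun a => kap a w *: v).
  by move=> c a b; rewrite killingDl killingZl scalerDl scalerA.
have Psi_r w a : linear (fun b => kap a w *: b).
  by move=> c b b'; rewrite scalerDr !scalerA mulrC.
have PsiP : degree0_bilinear (br := br) E q Psi.
  split.
  - by move=> w c u v; rewrite /Psi linearP tcontr_linear.
  - move=> u c v w; rewrite /Psi /tcontr scaler_sumr -big_split; apply: eq_bigr => i _ /=.
    rewrite scaler_sumr -big_split; apply: eq_bigr => j _ /=.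
    by rewrite linearD /= killingZr scalerDl scalerDr !scalerA mulrCA mulrA.
  (* [x] acts on both factors of [G u]. The action on the factor paired with [w] cancels the term in
     [br x w] by invariance; the action on the other one gives [br x (Psi u w)]. *)
  move=> x u w x0 u1 w1; rewrite /Psi G_eq // /tens_der linearD /=.
  rewrite !tcontr_map // -adE tcontr_lin.
  rewrite -[X in _ = X + _]addrC -addrA -[LHS]addr0; congr (_ + _).
    by apply: eq_tcontr => a b; rewrite id_lfunE linearZ.
  rewrite /tcontr -big_split big1 // => i _ /=; rewrite -big_split big1 // => j _ /=.
  by rewrite !adE !id_lfunE -scalerDr -scalerDl killing_brN addNr scale0r scaler0.
have [c PsiE] := degree0_bilinear_unique h_cartan DeltaP nd aE aD sgn PsiP br_neq0.
have [u0 [w0 [u01 w01 uw0]]] := br_neq0.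
have u00 : u0 != 0 by apply: contraNneq uw0 => ->; rewrite br0l.
have [bX bXs kX] := XXs.
have X2 k : deg 2%:R (tnth X k) by apply/grad2/(basis_mem bX); exact: mem_tnth.
have Xs2 k : deg (- 2%:R) (tnth Xs k) by apply/gradm2/(basis_mem bXs); exact: mem_tnth.
have [c' c'0 ZE] := dual_bases_br_sum h_cartan DeltaP nd aE aD sgn X2 Xs2 kX
  dual_basis_expand2 dual_basis_expandN2 m_gt0.
have deg3 x : deg 3%:R x -> x = 0.
  exact/(degree3_eq0 h_cartan DeltaP nd aE aD sgn)/(quasi_heisenberg_degree1 h_cartan DeltaP PiP EP q_qH).
(* Evaluating on [G y] gives the sum of [kap (Psi y (br x (Xs k))) (X k)]. Replacing [Psi] by [c]
   times the bracket and using [br (X k) x = 0], as g(3) is 0, leaves [c] times [kap y (br Z x)],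
   where [Z] is [c'] times the coweight. *)
have tauG y x : deg (-1) y -> deg 1 x -> c * (c' * kap y x) = 0.
  move=> y1 x1; have /grad1 xg := x1.
  rewrite -[RHS](tau0 _ (GV y) _ xg) tau1_tildeE.
  transitivity (\sum_k kap (Psi y (br x (tnth Xs k))) (tnth X k)).
    have xXs k : deg (-1) (br x (tnth Xs k)).
      by have := in_degree_br x1 (Xs2 k); rewrite -[2%:R]natr1 opprD addrCA subrr addr0.
    have X3 k : br (tnth X k) x = 0.
      by apply: deg3; have := in_degree_br (X2 k) x1; rewrite natr1.
    transitivity (c * kap y (br (\sum_k br (tnth X k) (tnth Xs k)) x)).
      by rewrite ZE brZl x1 scale1r killingZr.
    rewrite br_suml linear_sum mulr_sumr; apply: eq_bigr => k _ /=.
    rewrite PsiE // killingZl killing_br; congr (_ * kap y _).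
    by rewrite br_brl X3 br0r subr0 [RHS]brC (brC br x) linearN opprK.
  rewrite /Psi /tcontr; under eq_bigr do rewrite killing_suml.
  rewrite exchange_big; apply: eq_bigr => i _ /=; under eq_bigr do rewrite killing_suml.
  rewrite exchange_big; apply: eq_bigr => j _ /=.
  rewrite [RHS]mulr_sumr; apply: eq_bigr => k _.
  by rewrite !killingZl.
have c0 : c = 0.
  apply/eqP; apply: contraT => cn0; case/eqP: u00.
  apply: degreeN1_nondegenerate => // x x1.
  by have /eqP := tauG _ _ u01 x1; rewrite !mulf_eq0 (negPf cn0) (negPf c'0) => /eqP.
have Psi0 w : deg (-1) w -> Psi u0 w = 0 by move=> w1; rewrite PsiE // c0 scale0r.
have G0 : G u0 = 0.
  (* [Psi u0] only tests [G u0] against [d] of degree -1. In other degrees the contraction is 0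
     because the first factor lies in g(1); nondegeneracy then turns these contractions into all
     matrix entries. *)
  have kk0 d d' : tcontr (fun a b => kap a d * kap b d' : K^o) (G u0) = 0.
    move: d; apply: (weight_ind_full h_cartan) => [|k u v uE vE|b d db].
    - by rewrite /tcontr big1 // => i _; rewrite big1 // => j _; rewrite linear0 mul0r scaler0.
    - transitivity (k *: tcontr (fun a b => kap a u * kap b d' : K^o) (G u0)
        + tcontr (fun a b => kap a v * kap b d' : K^o) (G u0)).
        rewrite /tcontr scaler_sumr -big_split; apply: eq_bigr => i _ /=.
        rewrite scaler_sumr -big_split; apply: eq_bigr => j _ /=.
        rewrite linearD /= killingZr mulrDl scalerDr; congr (_ + _).
        by rewrite -mulrA [RHS]mulrCA.
      by rewrite uE vE scaler0 addr0.
    have [bq|bq] := eqVneq (b (E q) : K) (-1).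
      transitivity (kap (Psi u0 d) d').
        rewrite /Psi /tcontr killing_suml; apply: eq_bigr => i _.
        rewrite killing_suml; apply: eq_bigr => j _.
        by rewrite !killingZl.
      by rewrite Psi0 ?killing0l //; have := in_degree_root E q db; rewrite bq.
    move: (subvP V_sub _ (GV u0)); move: (G u0); apply: tens_space_ind => [|k Y Y' YE YE'|u v /grad1 u1 _].
    - exact: linear0.
    - by rewrite linearP /= YE YE' scaler0 addr0.
    rewrite tcontr_tens.
    - have [->|bq'] := eqVneq (kap u d) 0; first by rewrite mul0r.
      case/eqP: bq; have := killing_brN br (vsval (E q)) u d.
      rewrite u1 (in_degree_root E q db) killingZl killingZr -mulNr => /(mulIf bq') ->.
      by rewrite opprK.
    - by move=> w k y z' /=; rewrite killingDl killingZl mulrDl -mulrA.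
    - by move=> y k w z' /=; rewrite killingDl killingZl mulrDr mulrCA.
  have rep (i : 'I_(\dim {:g})) : exists d, forall a, kap d a = coord (vbasis {:g}) i a.
    apply: ex_pairing_rep => //.
    - by move=> u; exact: killing_linear.
    - by move=> w k u v /=; rewrite killingDl killingZl.
    - by move=> k u v; rewrite linearP.
  apply/matrixP => i j; rewrite tensor_coord mxE.
  have [d dE] := rep i; have [d' d'E] := rep j.
  rewrite -[RHS](kk0 d d'); apply: eq_tcontr => a b.
  by rewrite -dE -d'E (killingC br d) (killingC br d').
by case/eqP: u00; rewrite -(FG _ u01) G0 linear0.
Qed.

End Tau.

(** * The equivalence, passing between L and its Lie algebra *)

Theorem proposition5p4 (R : realType) (g : vectType R[i]) (br : lieBracket g)
    (g_simple : is_simple br)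
    (h : {vspace g}) (h_cartan : is_cartan br h)
    (Delta : seq (dual h)) (DeltaP : lists_roots br Delta)
    (r : nat) (Pi : r.-tuple (dual h)) (PiP : is_base Delta Pi)
    (q : 'I_r) (q_qH : quasi_heisenberg br Delta Pi q)
    (L : set 'End(g)) (L_levi : is_levi_subgroup br Delta Pi q L)
    (m : nat) (X Xs : m.-tuple g) (XXs : dual_bases br Delta Pi q X Xs)
    (V : {vspace tensor g g})
    (V_sub : (V <= tens_space (grading br Delta Pi q 1)
                              (grading br Delta Pi q (-2)))%VS)
    (V_irr : is_irreducible L tens_ad_action V) :
  ~ (forall Y, Y \in V ->
       forall x, x \in grading br Delta Pi q 1 -> tau1_tilde br X Xs Y x = 0)
  <-> module_iso L tens_ad_action V
        (fun (f : 'End(g)) (v : g) => f v) (grading br Delta Pi q (-1)).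
Proof.
have /choice[E EP'] := @ex_coweight _ g h r Pi.
have EP j b := EP' j b.
have nd := killing_nondegenerate h_cartan DeltaP PiP EP q g_simple.
have [_ L_sub _ _ L_lie] := L_levi.
have L_morph f : L f -> forall y z, f (br y z) = br (f y) (f z).
  by move=> /L_sub[fAd _]; exact: Ad_group_morphism fAd.
(* The last clause of [is_levi_subgroup] puts the whole group [exp (t ad x)] in [L]; stability and
   equivariance under g(0) are derived from it. *)
have L_exp x : in_degree (br := br) E q 0 x ->
    exists e : R[i] -> 'End(g), forall t, is_exp (t *: ad br x) (e t) /\ L (e t).
  move=> /(degree0_levi h_cartan DeltaP PiP EP) xl.
  have xL : lie_of_subgroup br L x by rewrite L_lie.
  have /choice[e eP] (t : R[i]) : exists e, is_exp (t *: ad br x) e /\ L e.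
    have [e eP Le] := xL t; exists e; split => //.
    suff <- : ad br (t *: x) = t *: ad br x by [].
    by apply/lfunP => y; rewrite scale_lfunE !adE brZl.
  by exists e.
have gradN1 x : x \in grading br Delta Pi q (-1) <-> in_degree (br := br) E q (-1) x.
  by have := gradingP h_cartan DeltaP EP q (-1) x; rewrite mulrNz.
have [V0 V_L V_min] := V_irr.
split=> [tau_neq0|[F [F_im F_inj F_eq]]].
  have [Y0 Y0V bY0] : exists2 Y, Y \in V & bracket_contr (br := br) Y != 0.
    apply: contrapT => nex; apply: tau_neq0 => Y YV x _.
    rewrite (tau1_tilde_bracket h_cartan DeltaP XXs EP) ?(subvP V_sub) //.
    have [->|bY] := eqVneq (bracket_contr (br := br) Y) 0; first by rewrite killing0l.
    by case: nex; exists Y.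
  pose F : 'Hom(tensor g g, g) := linfun (bracket_contr (br := br)).
  have FE Y : F Y = bracket_contr (br := br) Y by exact: lfunE.
  have F_eq f Y : L f -> F (tens_map f f Y) = f (F Y).
    move=> /L_morph fm; rewrite !FE /bracket_contr tcontr_map ?tcontr_lin.
    - by apply: eq_tcontr => u v; rewrite fm.
    - by move=> v; exact: bracket_linearr.
    - by move=> u; exact: bracket_linearl.
  have F_deg y : y \in (F @: V)%VS -> in_degree (br := br) E q (-1) y.
    move=> /memv_imgP[Y YV ->]; rewrite FE.
    exact/(bracket_contr_degree h_cartan DeltaP EP)/(subvP V_sub).
  exists F; split; last by move=> f Y Lf _; exact: F_eq.
  - apply/eqP; rewrite eqEsubv; apply/andP; split; apply/subvP => y.
      by move/F_deg/gradN1.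
    move/gradN1; apply: (degreeN1_irreducible h_cartan DeltaP nd
      (simple_root_coweight PiP EP) (simple_root_mem PiP) (base_sum PiP) F_deg).
      move=> x z /L_exp[e eP] zF; rewrite -adE.
      apply: (exp_stable (fun t => (eP t).1)) zF => t _ /memv_imgP[Y YV ->].
      by have [_ Let] := eP t; rewrite -F_eq // memv_img // V_L.
    apply: contraNneq bY0 => FV0; rewrite -memv0 -FV0 -FE; exact: memv_img.
  (* The kernel of phi in [V] is an [L]-submodule, so it is 0 or [V]; [Y0] excludes the latter. *)
  - have [||//|VF] := V_min (V :&: lker F)%VS; first exact: capvSl.
      move=> f Y Lf; rewrite !memv_cap !memv_ker => /andP[YV /eqP FY0].
      by rewrite [tens_ad_action _ _]/tens_map -/(tens_map f f Y) F_eq // FY0 linear0 eqxx andbT; exact: V_L.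
    case/eqP: bY0; apply/eqP; rewrite -FE -memv_ker.
    by apply: (subvP (capvSr V _)); rewrite VF.
apply: (equivariant_tau1_neq0 g_simple h_cartan DeltaP PiP q_qH XXs EP V_sub V0 (F := F)) => //.
- move=> x Y /L_exp[e eP]; apply: (exp_tensor_stable (fun t => (eP t).1)) => t Z ZV.
  by have [_ Let] := eP t; exact: V_L.
- move=> x Y /L_exp[e eP] YV; rewrite -adE.
  apply: (exp_equivariant (fun t => (eP t).1)) => t.
  by have [_ Let] := eP t; exact: F_eq.
- by move=> y; rewrite F_im.
Qed.
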